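(* Let $A$ be a unital semi-simple commutative Banach algebra, $U$ an automorphism of $A$ with induced homeomorphism $\varphi$, and $w \in A$. Let $T = wU$ and let $\check{T}$ be the associated weighted composition operator on $\check{A}$. Assume that $U^n \neq I$ for all $n \in \mathbb{N}$ and that $\sigma(\check{T}) \subseteq \mathbb{T}$. Assume additionally that $\partial A$ contains no $\varphi$-periodic points and that every point of $\partial A$ is a peak point for the algebra $\check{A}$. Then $\mathbb{T} \subseteq \sigma(T)$.
   Context: $A$ is a unital commutative semi-simple Banach algebra with maximal ideal space $\mathfrak{M}_A$ and Shilov boundary $\partial A$. For $f\in A$, $\check f$ is the restriction of the Gelfand transform $\hat f$ to $\partial A$; $\check A$ is the closure of $\{\check f : f\in A\}$ in $C(\partial A)$ with sup norm. The automorphism $U$ induces a homeomorphism $\varphi$ of $\mathfrak{M}_A$ by $\widehat{Uf}(m)=\hat f(\varphi(m))$, and $\varphi(\partial A)=\partial A$. $T=wU$ means $Tf=w\cdot Uf$; $\check T$ is the operator on $\check A$ given by $(\check Tg)(t)=\check w(t)g(\varphi(t))$, $t\in\partial A$. A point $t\in\partial A$ is $\varphi$-periodic if $\varphi^n(t)=t$ for some $n\in\mathbb{N}$. A point $t\in\partial A$ is a peak point for $\check A$ if there is $g\in\check A$ with $g(t)=1$ and $|g(s)|<1$ for all $s\in\partial A$, $s\neq t$. $\mathbb{T}$ is the unit circle. *)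

(* Defs.v *)
From HB Require Import structures.
From mathcomp Require Import all_boot all_order all_algebra.
From mathcomp Require Import all_classical all_reals.
From mathcomp Require Import topology normedtype.
From mathcomp Require Import complex.

Set Implicit Arguments.
Unset Strict Implicit.
Unset Printing Implicit Defensive.

Import Order.TTheory GRing.Theory Num.Theory.
Import numFieldNormedType.Exports.
Local Open Scope ring_scope.

Section BanachAlgebra.
Variable R : realType.
Local Notation C := (R[i]).
Variable A : completeNormedModType C.
Variable mul : A -> A -> A.
Variable one : A.

Record comBanachAlg : Prop := {
  mulA : forall x y z, mul x (mul y z) = mul (mul x y) z;
  mulC : forall x y, mul x y = mul y x;
  mul1x : forall x, mul one x = x;
  mulDl : forall (a : C) x y z, mul (a *: x + y) z = a *: mul x z + mul y z;
  norm_mul : forall x y, `|mul x y| <= `|x| * `|y|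
}.

(* Characters = points of the maximal ideal space M_A: nonzero (unital)      *)
(* multiplicative linear functionals A -> C.                                 *)
Record character := Character {
  chf :> A -> C;
  _ : forall (a : C) x y, chf (a *: x + y) = a * chf x + chf y;
  _ : forall x y, chf (mul x y) = chf x * chf y;
  _ : chf one = 1
}.

Definition semisimple : Prop :=
  forall f : A, (forall m : character, m f = 0) -> f = 0.

(* Gelfand (weak-star) topology on M_A: m is in the closure of S iff every   *)
(* basic neighbourhood {m' | |m' f_i - m f_i| < eps, i < n} meets S.         *)
Definition gelfand_closure (S : set character) : set character :=
  fun m => forall (n : nat) (fs : 'I_n -> A) (eps : R), 0 < eps ->
    exists2 s, S s & forall i, `|s (fs i) - m (fs i)| < (eps%:C)%C.

Definition gelfand_closed (S : set character) : Prop :=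
  forall m, gelfand_closure S m -> S m.

Definition boundary (B : set character) : Prop :=
  forall f : A, exists2 b, B b & forall m : character, `|m f| <= `|b f|.

Definition shilov : set character :=
  fun t => forall B, gelfand_closed B -> boundary B -> B t.

(* Elements of C(dA) are represented by functions character -> C, considered *)
(* only through their values on the Shilov boundary.                         *)
Definition eqOnS (g h : character -> C) : Prop :=
  forall t, shilov t -> g t = h t.

Definition checkA : set (character -> C) :=
  fun g => forall eps : R, 0 < eps ->
    exists f : A, forall t, shilov t -> `|g t - t f| < (eps%:C)%C.

Record algAut := AlgAut {
  autf :> A -> A;
  _ : forall (a : C) x y, autf (a *: x + y) = a *: autf x + autf y;
  _ : forall x y, autf (mul x y) = mul (autf x) (autf y);
  _ : autf one = one;
  _ : bijective autf
}.

Section Induced.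
Variable U : algAut.

Lemma phi_lin (m : character) (a : C) x y :
  (m \o U) (a *: x + y) = a * (m \o U) x + (m \o U) y.
Proof. by case: U m => u Ul Um U1 Ub [f fl fm f1] /=; rewrite Ul fl. Qed.

Lemma phi_mul (m : character) x y :
  (m \o U) (mul x y) = (m \o U) x * (m \o U) y.
Proof. by case: U m => u Ul Um U1 Ub [f fl fm f1] /=; rewrite Um fm. Qed.

Lemma phi_one (m : character) : (m \o U) one = 1.
Proof. by case: U m => u Ul Um U1 Ub [f fl fm f1] /=; rewrite U1 f1. Qed.

(* The induced map phi on M_A: (Uf)^(m) = f^(phi m), i.e. phi m = m o U. *)
Definition phi (m : character) : character :=
  Character (phi_lin m) (phi_mul m) (phi_one m).

Definition wcomp (w : A) (f : A) : A := mul w (U f).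

Definition check_wcomp (w : A) (g : character -> C) : character -> C :=
  fun t => t w * g (phi t).

End Induced.

Definition spectrum (T : A -> A) : set C :=
  fun lam => ~ exists S : A -> A,
    [/\ forall (a : C) x y, S (a *: x + y) = a *: S x + S y,
        exists K : R, forall x, `|S x| <= (K%:C)%C * `|x|,
        forall x, S (T x - lam *: x) = x &
        forall x, T (S x) - lam *: S x = x].

Definition check_spectrum (T : (character -> C) -> (character -> C)) : set C :=
  fun lam => ~ exists S : (character -> C) -> (character -> C),
    [/\ forall g, checkA g -> checkA (S g),
        (forall g h, checkA g -> checkA h -> eqOnS g h -> eqOnS (S g) (S h)) /\
        (forall (a : C) g h, checkA g -> checkA h ->
          eqOnS (S (fun t => a * g t + h t)) (fun t => a * S g t + S h t)),
        exists K : R, forall g (M : R), checkA g ->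
          (forall t, shilov t -> `|g t| <= (M%:C)%C) ->
          forall t, shilov t -> `|S g t| <= ((K * M)%:C)%C,
        forall g, checkA g -> eqOnS (S (fun t => T g t - lam * g t)) g &
        forall g, checkA g -> eqOnS (fun t => T (S g) t - lam * S g t) g].

Definition peak_point (t : character) : Prop :=
  exists g, [/\ checkA g, g t = 1 &
    forall s, shilov s -> s <> t -> `|g s| < 1].

Definition periodic (p : character -> character) (t : character) : Prop :=
  exists2 n : nat, (0 < n)%N & iter n p t = t.

End BanachAlgebra.

(* Main.v *)
(* Suppose [lam] is on the unit circle and [S = (T - lam)^-1] exists on [A], with
   norm at most [K].  For [t] in the Shilov boundary let [w_k] be the cocycle of
   weights along the orbit of [t].  The spectral hypothesis on the operator on the
   uniform algebra makes [w_k] and [1 / w_k] subexponential.  Since [t] is a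
   non-periodic peak point, some [g] in [A] has [g(t) = 1], [|g| <= 2], and [|g|]
   small along the orbit except at return times, whose gaps exceed any prescribed
   [N].  Put [h = g^m].  The sequence [x_k = lam^-k w_k (S^m h)(phi^k t)] is
   bounded by [K^m] times a subexponential factor and [|h|_A <= C 4^m] (spectral
   radius formula), while its [m]-th difference is, up to a phase,
   [lam^-k w_k h(phi^k t)].  Pairing with a finitely supported sequence [c] such
   that [c_0 = 1], [c] vanishes at the other return times and the [m]-th
   difference of [c] is at most [theta^m], with [theta] small compared with [1 / K]
   (a quantitative form of the Fabry gap theorem), gives a contradiction as [m]
   tends to infinity. *)

Require Import Defs.
From HB Require Import structures.
From mathcomp Require Import all_boot all_order all_algebra.
From mathcomp Require Import all_classical all_reals.
From mathcomp Require Import topology normedtype.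
From mathcomp Require Import complex.
From mathcomp Require Import zify ring lra.
Import Order.TTheory GRing.Theory Num.Theory.
Import numFieldNormedType.Exports.
Local Open Scope ring_scope.

Set Implicit Arguments.
Unset Strict Implicit.
Unset Printing Implicit Defensive.

(** The norm of [A] is not controlled by values on the Shilov boundary, so an element [g] that is
    small on most of an orbit may have a huge norm. Passing to [g^m] removes this obstacle: the
    norms of powers follow the supremum up to a factor 2 and a constant independent of [m]. What
    remains is a competition of rates. The resolvent, the norm of [h], the weights and the
    prescribed zeros cost factors [K^m], [4^m], [2^m] and [16^m]; the [m]-th difference returns
    [(2 / q)^m], with [q] chosen from [K] alone. Away from the return times the smallness of [g]
    pays instead. The quantifiers are delicate: [q] precedes [g], [g] precedes [m], and [m] precedes
    the normalised index [k0], which is the place of a large coefficient of an averaging polynomial.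
    The orbit starts [k0] steps before [t], so its return times depend on [k0], and [k0] may not
    depend on them. No contour integral is available for the spectral radius formula; averaging over
    roots of -1 replaces it, and the same estimate yields Gelfand-Mazur, the growth of powers and
    the bounds on the weights. *)

(* Norms over [R[i]] take values in [R[i]]; [nm] is the same norm read in [R]. *)
Definition nm (R : realType) (V : normedZmodType R[i]) (x : V) : R :=
  complex.Re `|x|.

(** * Real-valued norms over the complex scalars *)

Section RealNorm.
Variable R : realType.
Local Notation C := R[i].

Lemma nmE (V : normedZmodType C) (x : V) : ((nm x)%:C)%C = `|x|.
Proof. by rewrite /nm RRe_real // normr_real. Qed.

Lemma nm_le (V W : normedZmodType C) (x : V) (y : W) :
  (`|x| <= `|y|) = (nm x <= nm y).
Proof. by rewrite -!nmE lecR. Qed.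

Lemma nm_leC (V : normedZmodType C) (x : V) (e : R) :
  (`|x| <= (e%:C)%C) = (nm x <= e).
Proof. by rewrite -nmE lecR. Qed.

Lemma nm_ltC (V : normedZmodType C) (x : V) (e : R) :
  (`|x| < (e%:C)%C) = (nm x < e).
Proof. by rewrite -nmE ltcR. Qed.

Lemma nm_ge0 (V : normedZmodType C) (x : V) : 0 <= nm x.
Proof. by rewrite -lecR nmE normr_ge0. Qed.

Lemma nm0 (V : normedZmodType C) : nm (0 : V) = 0.
Proof. by rewrite /nm normr0. Qed.

Lemma nm_eq0 (V : normedZmodType C) (x : V) : nm x = 0 -> x = 0.
Proof. by move=> x0; apply/normr0_eq0; rewrite -nmE x0. Qed.

Lemma nmD (V : normedZmodType C) (x y : V) : nm (x + y) <= nm x + nm y.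
Proof. by rewrite -lecR rmorphD /= !nmE ler_normD. Qed.

Lemma nmN (V : normedZmodType C) (x : V) : nm (- x) = nm x.
Proof. by rewrite /nm normrN. Qed.

Lemma nmB (V : normedZmodType C) (x y : V) : nm (x - y) <= nm x + nm y.
Proof. by rewrite -(nmN y) nmD. Qed.

Lemma nmBC (V : normedZmodType C) (x y : V) : nm (x - y) = nm (y - x).
Proof. by rewrite -nmN opprB. Qed.

Lemma nm_tri (V : normedZmodType C) (x y : V) : nm x <= nm y + nm (x - y).
Proof. by rewrite -{1}(subrKC y x) nmD. Qed.

Lemma nmZ (V : normedModType C) (a : C) (x : V) : nm (a *: x) = nm a * nm x.
Proof.
by apply: (@complexI R); rewrite rmorphM /= !nmE normrZ.
Qed.

Lemma nmM (a b : C) : nm (a * b) = nm a * nm b.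
Proof. by apply: (@complexI R); rewrite rmorphM /= !nmE normrM. Qed.

Lemma nm1 : nm (1 : C) = 1.
Proof. by rewrite /nm normr1. Qed.

Lemma nmX (a : C) n : nm (a ^+ n) = nm a ^+ n.
Proof. by elim: n => [|n IH]; rewrite ?nm1 // !exprS nmM IH. Qed.

Lemma nmV (a : C) : nm a^-1 = (nm a)^-1.
Proof. by apply: (@complexI R); rewrite fmorphV /= !nmE normfV. Qed.

Lemma nmC (x : R) : nm ((x%:C)%C) = `|x|.
Proof.
by rewrite /nm normc_def /= expr0n addr0 sqrtr_sqr.
Qed.

Lemma nm_Re (z : C) : `|complex.Re z| <= nm z.
Proof. by rewrite -lecR nmE normc_ge_Re. Qed.

Lemma nm_Im (z : C) : `|complex.Im z| <= nm z.
Proof.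
have := nm_Re (z * 'i%C); rewrite ReiNIm normrN nmM.
suff -> : nm ('i%C : C) = 1 by rewrite mulr1.
by rewrite /nm normc_def /= expr0n expr1n add0r sqrtr1.
Qed.

Lemma nm_ReIm (z : C) : nm z <= `|complex.Re z| + `|complex.Im z|.
Proof.
rewrite {1}(complexE z); apply: le_trans (nmD _ _) _; rewrite nmM !nmC lerD2l.
suff -> : nm ('i%C : C) = 1 by rewrite mul1r.
by rewrite /nm normc_def /= expr0n expr1n add0r sqrtr1.
Qed.

Lemma nm_sum (V : normedZmodType C) n (F : nat -> V) :
  nm (\sum_(i < n) F i) <= \sum_(i < n) nm (F i).
Proof.
elim: n => [|n IH]; first by rewrite !big_ord0 nm0.
by rewrite !big_ord_recr /=; apply: le_trans (nmD _ _) _; rewrite lerD2r.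
Qed.

End RealNorm.

(** * Compactness of closed discs *)

Section DiscCompactness.
Variable R : realType.
Local Notation C := R[i].
Local Open Scope classical_set_scope.

(** If no bound works uniformly, points violating the bounds [n] cluster in a compact square, and
    the local bound near a cluster point is contradicted. *)
Lemma disc_uniform_bound (rho : R) (B : C -> R -> Prop) :
  (forall z M M', M <= M' -> B z M -> B z M') ->
  (forall z, nm z <= rho -> exists M e, 0 < e /\
     forall z', nm z' <= rho -> nm (z' - z) < e -> B z' M) ->
  exists M, forall z, nm z <= rho -> B z M.
Proof.
move=> Bmono Bloc; apply: contrapT => nB.
have /choice[u uP] : forall n : nat, exists z, nm z <= rho /\ ~ B z n%:R.
  move=> n; apply: contrapT => H; apply: nB; exists n%:R => z zr.
  by apply: contrapT => Bz; apply: H; exists z.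
have cpt : compact (`[- rho, rho] `*` `[- rho, rho] : set (R * R)).
  by apply: compact_setX; exact: segment_compact.
pose v n : R * R := (complex.Re (u n), complex.Im (u n)).
have Fv : (v @ \oo) (`[- rho, rho] `*` `[- rho, rho]).
  exists 0%N => // n _; have [un _] := uP n.
  split => /=; rewrite in_itv /= -ler_norml.
    exact: le_trans (nm_Re _) un.
  exact: le_trans (nm_Im _) un.
have [[a b] [_ cl]] := cpt _ _ Fv.
pose z : C := (a +i* b)%C.
have [M [e [e0 He]]] : exists M e, 0 < e /\
     forall z', nm z' <= rho -> nm (z' - z) < e -> B z' M.
  (* The cluster point need not be located in the disc: outside it, a ball missing the disc makes
     the claim vacuous. *)
  have [/Bloc//|zr] := leP (nm z) rho.
  exists 0, (nm z - rho); split; first by rewrite subr_gt0.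
  move=> z' z'r; have := nm_tri z z'; rewrite (nmBC z' z) => h1 h2; lra.
have e2 : 0 < e / 2 by lra.
pose n0 := Num.bound `|M|.
have S1 : (v @ \oo) (v @` [set n | (n0 <= n)%N]).
  by exists n0 => // n /= nn0; exists n.
have S2 : nbhs ((a, b) : R * R) (ball a (e / 2) `*` ball b (e / 2)).
  by exists (ball a (e / 2), ball b (e / 2)) => //; split; exact: nbhsx_ballx.
have [_ [[n nn0 <-] /= [h1 h2]]] := cl _ _ S1 S2.
have [un nBn] := uP n; apply: nBn.
apply: (Bmono _ M).
  apply: ltW; apply: le_lt_trans (ler_norm _) _.
  by apply: lt_le_trans (archi_boundP (normr_ge0 _)) _; rewrite ler_nat.
apply: He => //; apply: le_lt_trans (nm_ReIm _) _.
move: h1 h2; rewrite /ball /= => h1 h2.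
have -> : complex.Re (u n - z) = complex.Re (u n) - a by case: (u n).
have -> : complex.Im (u n - z) = complex.Im (u n) - b by case: (u n).
rewrite distrC (distrC _ b); lra.
Qed.

End DiscCompactness.

Lemma power_decay (R : realType) (a e : R) : 0 <= a < 1 -> 0 < e ->
  exists n0, forall n, (n0 <= n)%N -> a ^+ n <= e.
Proof.
move=> /andP[a_ge0 a_lt1] e_gt0.
have [->|a_neq0] := eqVneq a 0.
  by exists 1%N => -[//|n] _; rewrite expr0n /= ltW.
have a_gt0 : 0 < a by rewrite lt_neqAle eq_sym a_neq0.
have bern h n : 0 <= h -> 1 + h * n%:R <= (1 + h) ^+ n :> R.
  move=> h0; elim: n => [|n IH]; first by rewrite mulr0 addr0.
  rewrite exprS -natr1; have hn : 0 <= h * n%:R by rewrite mulr_ge0.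
  have := ler_wpM2l (_ : 0 <= 1 + h) IH; rewrite addr_ge0 // => /(_ isT).
  apply: le_trans; have : 0 <= h * (h * n%:R) by rewrite mulr_ge0.
  lra.
pose h := a^-1 - 1.
have h_gt0 : 0 < h by rewrite subr_gt0 invf_gt1.
exists (Num.bound (e^-1 / h)) => n nb.
rewrite -(invrK a) exprVn -(invrK e) lef_pV2 ?posrE ?exprn_gt0 ?invr_gt0 //.
have -> : a^-1 = 1 + h by rewrite /h; lra.
apply: le_trans (bern _ _ (ltW h_gt0)).
have := @archi_boundP _ (e^-1 / h); rewrite divr_ge0 ?invr_ge0 ?(ltW h_gt0) ?(ltW e_gt0) //.
move=> /(_ isT); rewrite ltr_pdivrMr // => H.
have : (Num.bound (e^-1 / h))%:R * h <= n%:R * h.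
  by rewrite ler_pM2r // ler_nat.
lra.
Qed.

(** * Spectral radius formula *)

(* An operator form, on a subspace [D] with a seminorm [q]; it serves the algebra,
   its quotients and the uniform algebra alike.  Writing [n = 2^k], the solution
   [y_k(z)] of [y - z^n T^n y = x] is the average of [y_(k-1)(z)] and
   [y_(k-1)(zeta z)] with [zeta^(n/2) = -1], so it is Lipschitz in [z] uniformly in
   [k]; hence the radius at which [z^n T^n] tends to [0] can be increased by a
   fixed amount. *)
Section SpectralRadius.
Variables (R : realType) (X : lmodType R[i]) (D : X -> Prop) (q : X -> R).
Variables (T : X -> X) (tau rho : R).
Local Notation C := R[i].
Hypothesis DD : forall x y, D x -> D y -> D (x + y).
Hypothesis DZ : forall a x, D x -> D (a *: x).
Hypothesis q_ge0 : forall x, D x -> 0 <= q x.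
Hypothesis qD : forall x y, D x -> D y -> q (x + y) <= q x + q y.
Hypothesis qZ : forall a x, D x -> q (a *: x) <= nm a * q x.
Hypothesis T_lin : forall a x y, T (a *: x + y) = a *: T x + T y.
Hypothesis DT : forall x, D x -> D (T x).
Hypothesis tau_ge0 : 0 <= tau.
Hypothesis qT : forall x, D x -> q (T x) <= tau * q x.
Hypothesis rho_gt0 : 0 < rho.
Hypothesis T_below : forall z, nm z <= rho ->
  exists M, forall x, D x -> q x <= M * q (x - z *: T x).
(** Solutions are asked for only up to [q]-null vectors, because in a quotient of [A], or for
    functions read on the Shilov boundary, equality amounts to [q] vanishing on the difference. *)
Hypothesis T_onto : forall z, nm z <= rho -> forall x, D x ->
  exists y, D y /\ q (y - z *: T y - x) = 0.

Let DN x : D x -> D (- x).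
Proof. by move=> Dx; rewrite -scaleN1r; exact: DZ. Qed.

Let DB x y : D x -> D y -> D (x - y).
Proof. by move=> Dx Dy; apply: DD => //; exact: DN. Qed.

Let qN x : D x -> q (- x) = q x.
Proof.
have H y : D y -> q (- y) <= q y.
  by move=> Dy; rewrite -scaleN1r (le_trans (qZ _ _)) // nmN nm1 mul1r.
move=> Dx; apply/eqP; rewrite eq_le H //=.
by have := H _ (DN Dx); rewrite opprK.
Qed.

Let qB x y : D x -> D y -> q (x - y) <= q x + q y.
Proof. by move=> Dx Dy; rewrite -(qN Dy) qD //; exact: DN. Qed.

Let qtri x y : D x -> D y -> q x <= q y + q (x - y).
Proof. by move=> Dx Dy; rewrite -{1}(subrKC y x) qD //; exact: DB. Qed.

Let qnull x y : D x -> D y -> q y = 0 -> q (x + y) <= q x.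
Proof. by move=> Dx Dy y0; have := qD Dx Dy; rewrite y0 addr0. Qed.

Let Tn_lin n a x y : iter n T (a *: x + y) = a *: iter n T x + iter n T y.
Proof. by elim: n => //= n ->. Qed.

Let D_Tn n x : D x -> D (iter n T x).
Proof. by move=> Dx; elim: n => //= n; exact: DT. Qed.

Let q_Tn n x : D x -> q (iter n T x) <= tau ^+ n * q x.
Proof.
move=> Dx; elim: n => [|n IH] /=; first by rewrite mul1r.
apply: le_trans (qT (D_Tn n Dx)) _.
by rewrite exprS -mulrA ler_wpM2l.
Qed.

Let P z n x := x - z ^+ n *: iter n T x.

Let P_lin z n a x y : P z n (a *: x + y) = a *: P z n x + P z n y.
Proof.
by rewrite /P Tn_lin scalerDr scalerBr !scalerA mulrC opprD addrACA.
Qed.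

Let P0 z n : P z n 0 = 0.
Proof. by have := P_lin z n (-1) 0 0; rewrite scaler0 addr0 scaleN1r addNr. Qed.

Let PB z n x y : P z n (x - y) = P z n x - P z n y.
Proof. by rewrite addrC -scaleN1r P_lin scaleN1r addrC. Qed.

Let D_P z n x : D x -> D (P z n x).
Proof. by move=> Dx; apply: DB => //; apply: DZ; exact: D_Tn. Qed.

Let q_P z n x : D x -> q (P z n x) <= (1 + nm (z ^+ n) * tau ^+ n) * q x.
Proof.
move=> Dx; apply: le_trans (qB _ _) _ => //; first by apply: DZ; exact: D_Tn.
rewrite mulrDl mul1r lerD2l -mulrA; apply: le_trans (qZ _ _) _.
  exact: D_Tn.
by apply: ler_wpM2l; [exact: nm_ge0|exact: q_Tn].
Qed.

Let P_null z n x : D x -> q x = 0 -> q (P z n x) = 0.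
Proof.
move=> Dx x0; apply/eqP; rewrite eq_le q_ge0 ?andbT; last exact: D_P.
by have := q_P z n Dx; rewrite x0 mulr0.
Qed.

(* [1 - a^2 = (1 - a) (1 + a)] for [a = z^n T^n]. *)
Let P_double z z' n x : z' ^+ n = - z ^+ n ->
  P z (n + n) x = P z n (P z' n x).
Proof.
move=> zz'; rewrite /P zz' scaleNr opprK.
have -> : iter n T (x + z ^+ n *: iter n T x) =
    z ^+ n *: iter n T (iter n T x) + iter n T x by rewrite addrC Tn_lin.
rewrite -iterD scalerDr scalerA -exprD opprD [- (z ^+ (n + n) *: _) - _]addrC.
by rewrite addrA addrK.
Qed.

Let root_ex (k : nat) : exists zeta : C, zeta ^+ (2 ^ k) = -1 /\ nm zeta = 1.
Proof.
exists ((2 ^ k).-root (-1)); have k0 : (0 < 2 ^ k)%N by rewrite expn_gt0.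
have H := rootCK k0 (-1 : C); split=> //.
apply/eqP; rewrite -(@pexpr_eq1 _ _ (2 ^ k)) ?nm_ge0 //.
by rewrite -nmX H nmN nm1.
Qed.

(** Each doubling splits [1 - z^(2n) T^(2n)] into two factors whose parameters have the modulus of
    [z], so injectivity up to null vectors descends to exponent 1, where [T_below] provides it. *)
Let P_inj k z x : nm z <= rho -> D x -> q (P z (2 ^ k) x) = 0 -> q x = 0.
Proof.
elim: k z x => [|k IH] z x zr Dx.
  rewrite /P expn0 expr1 /= => Px0; apply/eqP; rewrite eq_le q_ge0 // andbT.
  by have [M HM] := T_below zr; have := HM _ Dx; rewrite Px0 mulr0.
rewrite expnS mul2n -addnn; have [zeta [zk z1]] := root_ex k.
rewrite (@P_double z (zeta * z)) ?exprMn ?zk ?mulN1r // => H.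
by apply: (IH (zeta * z)) => //; [rewrite nmM z1 mul1r|apply: (IH z) => //; exact: D_P].
Qed.

(** Moving [z] to [z'] costs at most [nm (z' - z) * tau * q x]. For close [z'] this is absorbed into
    the left side at the price of doubling the constant, and compactness of the disc does the
    rest. *)
Let uniform_below : exists M, 0 < M /\
  forall z, nm z <= rho -> forall x, D x -> q x <= M * q (x - z *: T x).
Proof.
have DP z x : D x -> D (x - z *: T x).
  by move=> Dx; apply: DB => //; apply: DZ; exact: DT.
have [||M HM] := @disc_uniform_bound R rho
  (fun z M => forall x, D x -> q x <= M * q (x - z *: T x)).
- move=> z M M' MM' H x Dx; apply: le_trans (H _ Dx) _.
  by apply: ler_wpM2r => //; apply: q_ge0; exact: DP.
- move=> z zr; have [M HM] := T_below zr.
  pose M1 := `|M| + 1; have M1_gt0 : 0 < M1 by rewrite ltr_wpDl.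
  have tau1 : 0 < tau + 1 by rewrite ltr_wpDl.
  exists (2 * M1), (2 * M1 * (tau + 1))^-1; split.
    by rewrite invr_gt0 !mulr_gt0.
  move=> z' z'r zz' x Dx.
  have h1 : q x <= M1 * q (x - z *: T x).
    apply: le_trans (HM _ Dx) _; apply: ler_wpM2r; first exact: q_ge0 (DP _ _ Dx).
    by apply: le_trans (ler_norm _) _; rewrite lerDl.
  have h2 : q (x - z *: T x) <= q (x - z' *: T x) + nm (z' - z) * (tau * q x).
    have -> : x - z *: T x = (x - z' *: T x) + (z' - z) *: T x.
      by rewrite scalerBl addrA subrK.
    apply: le_trans (qD _ _) _; [exact: DP|apply: DZ; exact: DT|].
    rewrite lerD2l; apply: le_trans (qZ _ (DT Dx)) _.
    by rewrite ler_wpM2l ?nm_ge0 // qT.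
  have h3 : M1 * (nm (z' - z) * (tau * q x)) <= q x / 2.
    have qx := q_ge0 Dx.
    have : nm (z' - z) * (2 * M1 * (tau + 1)) <= 1.
      by rewrite -ler_pdivlMr ?mulr_gt0 // div1r ltW.
    move=> h; have := nm_ge0 (z' - z) => h'.
    have : nm (z' - z) * (2 * M1 * tau) <= 1.
      apply: le_trans h; rewrite ler_wpM2l // ler_wpM2l ?lerDl //.
      by rewrite mulr_ge0 // ltW.
    move=> /(ler_wpM2r qx); lra.
  have : M1 * q (x - z *: T x) <= M1 * q (x - z' *: T x) + M1 * (nm (z' - z) * (tau * q x)).
    by rewrite -mulrDr ler_wpM2l // ltW.
  lra.
exists (`|M| + 1); split; first by rewrite ltr_wpDl.
move=> z zr x Dx; apply: le_trans (HM _ zr _ Dx) _.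
apply: ler_wpM2r; first exact: q_ge0 (DP _ _ Dx).
by apply: le_trans (ler_norm _) _; rewrite lerDl.
Qed.

Let lipschitz_solutions : exists Lam, 0 < Lam /\ forall k,
  exists Y : C -> X -> X,
    (forall z x, nm z <= rho -> D x ->
       D (Y z x) /\ q (P z (2 ^ k) (Y z x) - x) = 0) /\
    (forall z z' x, nm z <= rho -> nm z' <= rho -> D x ->
       q (Y z x - Y z' x) <= Lam * nm (z - z') * q x).
Proof.
have [M [M_gt0 HM]] := uniform_below.
(* The resolvent identity [R(z) - R(z') = (z - z') R(z) T R(z')] gives this Lipschitz constant at
   exponent 1; averaging preserves it, since multiplication by [zeta] preserves distances. *)
exists (M * (tau + 1) * M); split; first by rewrite !mulr_gt0 // ltr_wpDl.
elim=> [|k [Y [Ysol Ylip]]].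
  have /choice[Y0 HY0] : forall zx : C * X, exists y, nm zx.1 <= rho -> D zx.2 ->
      D y /\ q (y - zx.1 *: T y - zx.2) = 0.
    move=> [z x] /=; have [zr|] := boolP (nm z <= rho); last by exists 0.
    have [Dx|nDx] := pselect (D x); last by exists 0 => _ /nDx.
    by have [y Hy] := T_onto zr Dx; exists y.
  exists (fun z x => Y0 (z, x)); split.
    move=> z x zr Dx; exact: HY0 (z, x) zr Dx.
  move=> z z' x zr z'r Dx.
  have [/= Dy Hy] := HY0 (z, x) zr Dx; have [/= Dy' Hy'] := HY0 (z', x) z'r Dx.
  set y := Y0 _ in Dy Hy *; set y' := Y0 _ in Dy' Hy' *.
  have DTy' := DT Dy'; have DTy := DT Dy.
  have Dr : D (y - z *: T y - x) by apply: DB => //; apply: DB => //; exact: DZ.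
  have Dr' : D (y' - z' *: T y' - x) by apply: DB => //; apply: DB => //; exact: DZ.
  have qy' : q y' <= M * q x.
    apply: le_trans (HM _ z'r _ Dy') _; apply: ler_wpM2l; first exact: ltW.
    apply: le_trans (qtri _ Dx) _; first by apply: DB => //; exact: DZ.
    by rewrite Hy' addr0.
  apply: le_trans (HM _ zr _ (DB Dy Dy')) _.
  rewrite -!mulrA; apply: ler_wpM2l; first exact: ltW.
  have -> : y - y' - z *: T (y - y') =
      (z - z') *: T y' + (y - z *: T y - x) - (y' - z' *: T y' - x).
    have -> : T (y - y') = T y - T y'.
      by rewrite addrC -scaleN1r T_lin scaleN1r addrC.
    rewrite scalerBr scalerBl -[RHS]addrA [- (_ - _ - x)]opprB.
    rewrite (addrA (_ - _ - x)) subrK [- (y' - _)]opprB addrCA (addrA (_ - _) (_ *: _)).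
    by rewrite subrK opprB addrACA [in RHS]addrACA [- _ - z *: _]addrC.
  have DZ' : D ((z - z') *: T y') by apply: DZ.
  apply: le_trans (qB (DD DZ' Dr) Dr') _; rewrite Hy' addr0.
  apply: le_trans (qnull DZ' Dr Hy) _.
  apply: le_trans (qZ _ DTy') _.
  have qTy' : q (T y') <= (tau + 1) * (M * q x).
    apply: le_trans (qT Dy') _; apply: ler_pM => //; first exact: q_ge0.
    by rewrite lerDl.
  have -> : (tau + 1) * (M * (nm (z - z') * q x)) =
      nm (z - z') * ((tau + 1) * (M * q x)) by ring.
  by rewrite ler_wpM2l // nm_ge0.
have [zeta [zk z1]] := root_ex k.
have z1' z : nm (zeta * z) = nm z by rewrite nmM z1 mul1r.
have zn z : (zeta * z) ^+ (2 ^ k) = - z ^+ (2 ^ k) by rewrite exprMn zk mulN1r.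
exists (fun z x => 2^-1 *: (Y z x + Y (zeta * z) x)); split.
  move=> z x zr Dx; have [Dy Hy] := Ysol z x zr Dx.
  have z'r : nm (zeta * z) <= rho by rewrite z1'.
  have [Dy' Hy'] := Ysol (zeta * z) x z'r Dx.
  split; first by apply: DZ; exact: DD.
  rewrite expnS mul2n -addnn; set n := (2 ^ k)%N in Hy Hy' zn *.
  set y := Y z x in Hy Dy *; set y' := Y (zeta * z) x in Hy' Dy' *.
  have Dr : D (P z n y - x) by apply: DB => //; exact: D_P.
  have Dr' : D (P (zeta * z) n y' - x) by apply: DB => //; exact: D_P.
  (* This is [1/(1 - a^2) = (1/(1 - a) + 1/(1 + a)) / 2] with the null residuals carried along. *)
  have -> : P z (n + n) (2^-1 *: (y + y')) - x =
      2^-1 *: (P (zeta * z) n (P z n y - x) + P z n (P (zeta * z) n y' - x)).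
    rewrite (PB (zeta * z) n (P z n y)) (PB z n (P (zeta * z) n y')).
    rewrite -(@P_double z (zeta * z)) // -(@P_double (zeta * z) z); last first.
      by rewrite zn opprK.
    have -> : P (zeta * z) (n + n) y = P z (n + n) y.
      by rewrite /P !exprD zn mulrNN.
    have Pxx : P (zeta * z) n x + P z n x = 2 *: x.
      by rewrite /P zn scaleNr opprK addrACA subrr addr0 scaler_nat.
    rewrite addrACA -opprD Pxx scalerBr scalerA mulVf ?pnatr_eq0 // scale1r.
    congr (_ - _); rewrite -[X in P _ _ X]addr0 P_lin P0 addr0; congr (_ *: _).
    by rewrite -[y]scale1r P_lin !scale1r.
  apply/eqP; rewrite eq_le q_ge0 ?andbT; last first.
    by apply: DZ; apply: DD; exact: D_P.
  apply: le_trans (qZ _ _) _; first by apply: DD; exact: D_P.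
  apply: le_trans (ler_wpM2l (nm_ge0 _) (qD _ _)) _; try exact: D_P.
  by rewrite !P_null // addr0 mulr0.
move=> z z' x zr z'r Dx.
have zr' : nm (zeta * z) <= rho by rewrite z1'.
have z'r' : nm (zeta * z') <= rho by rewrite z1'.
have [D1 _] := Ysol _ _ zr Dx; have [D2 _] := Ysol _ _ z'r Dx.
have [D3 _] := Ysol _ _ zr' Dx; have [D4 _] := Ysol _ _ z'r' Dx.
have h1 := Ylip _ _ _ zr z'r Dx; have h2 := Ylip _ _ _ zr' z'r' Dx.
rewrite -scalerBr opprD addrACA.
apply: le_trans (qZ _ (DD (DB D1 D2) (DB D3 D4))) _.
have -> : nm (2^-1 : C) = 2^-1.
  by rewrite nmV -[2]/(2%:R) -(rmorph_nat (@real_complex R)) nmC normr_nat.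
have h3 := qD (DB D1 D2) (DB D3 D4).
move: h2; rewrite -mulrBr z1' => h2; lra.
Qed.

(** At radius [r] the power is so small that the solution operator is close to the identity; the
    Lipschitz bound transports this to [r'], where it moves each [x] by at most [q x / 2]. Applied
    to [x = v - a v], with [a = r'^n T^n], whose solution is [v] up to a null vector, this reads
    [q (a v) <= q (v - a v) / 2], hence [q (a v) <= q v]. *)
Let root_step (r r' Lam : R) k (Y : C -> X -> X) :
  (forall z x, nm z <= rho -> D x ->
     D (Y z x) /\ q (P z (2 ^ k) (Y z x) - x) = 0) ->
  (forall z z' x, nm z <= rho -> nm z' <= rho -> D x ->
     q (Y z x - Y z' x) <= Lam * nm (z - z') * q x) ->
  0 <= r -> r <= r' -> r' <= rho -> Lam * (r' - r) <= 4^-1 ->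
  (forall x, D x -> q (iter (2 ^ k) T x) * r ^+ (2 ^ k) <= 8^-1 * q x) ->
  forall x, D x -> q (iter (2 ^ k) T x) * r' ^+ (2 ^ k) <= q x.
Proof.
move=> Ysol Ylip r0 rr' r'rho Lr Hr v Dv; set n := (2 ^ k)%N in Ysol Hr *.
have r'0 := le_trans r0 rr'.
pose z : C := (r%:C)%C; pose z' : C := (r'%:C)%C.
have nz : nm z = r by rewrite nmC ger0_norm.
have nz' : nm z' = r' by rewrite nmC ger0_norm.
have zr : nm z <= rho by rewrite nz (le_trans rr').
have z'r : nm z' <= rho by rewrite nz'.
have near_id x : D x -> q (Y z' x - x) <= 2^-1 * q x.
  move=> Dx; have [Dy Hy] := Ysol z x zr Dx; have [Dy' _] := Ysol z' x z'r Dx.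
  have Da : D (z ^+ n *: iter n T (Y z x)) by apply: DZ; exact: D_Tn.
  have qa : q (z ^+ n *: iter n T (Y z x)) <= 8^-1 * q (Y z x).
    apply: le_trans (qZ _ (D_Tn _ Dy)) _; rewrite nmX nz mulrC; exact: Hr.
  have h1 : q (Y z x - x) <= 8^-1 * q (Y z x).
    apply: le_trans _ qa.
    have -> : Y z x - x = z ^+ n *: iter n T (Y z x) + (P z n (Y z x) - x).
      by rewrite /P [RHS]addrA subrKC.
    by apply: qnull => //; apply: DB => //; exact: D_P.
  have h2 := qtri Dy Dx.
  have h3 := Ylip _ _ _ z'r zr Dx.
  have h4 : nm (z' - z) = r' - r by rewrite -rmorphB nmC ger0_norm // subr_ge0.
  have h5 : q (Y z' x - x) <= q (Y z' x - Y z x) + q (Y z x - x).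
    have -> : Y z' x - x = (Y z' x - Y z x) + (Y z x - x) by rewrite addrA subrK.
    by apply: qD; exact: DB.
  have h6 : Lam * nm (z' - z) * q x <= 4^-1 * q x.
    by rewrite h4 ler_wpM2r // q_ge0.
  have h7 := q_ge0 Dx; lra.
have Dx : D (P z' n v) by exact: D_P.
have [Dy Hy] := Ysol z' _ z'r Dx.
have yv : q (Y z' (P z' n v) - v) = 0.
  by apply: (P_inj (k := k) z'r); [exact: DB|rewrite PB].
have Da : D (z' ^+ n *: iter n T v) by apply: DZ; exact: D_Tn.
have h1 : q (z' ^+ n *: iter n T v) <= 2^-1 * q (P z' n v).
  apply: le_trans (near_id _ Dx).
  have -> : z' ^+ n *: iter n T v =
      (Y z' (P z' n v) - P z' n v) - (Y z' (P z' n v) - v).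
    by rewrite [- (_ - v)]opprB addrC addrA subrK /P opprB addrC subrK.
  by apply: le_trans (qB _ _) _; try exact: DB; rewrite yv addr0.
have h2 : q (P z' n v) <= q v + q (z' ^+ n *: iter n T v) by exact: qB.
have h3 : q (iter n T v) * r' ^+ n <= q (z' ^+ n *: iter n T v).
  have [r'z|r'nz] := eqVneq r' 0.
    rewrite r'z expr0n /n expn_eq0 /= mulr0; exact: q_ge0.
  have zn0 : z' ^+ n != 0.
    by apply: expf_neq0; apply/eqP => /(congr1 (@nm R _)); rewrite nz' nm0 => /eqP; apply/negP.
  have := qZ (z' ^+ n)^-1 Da; rewrite scalerA mulVf // scale1r nmV nmX nz'.
  by rewrite mulrC ler_pdivlMr // exprn_gt0 // lt_neqAle eq_sym r'nz.
lra.
Qed.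

Lemma spectral_radius_bound : exists K, 0 < K /\
  forall n x, D x -> q (iter n T x) * rho ^+ n <= K * q x.
Proof.
have [Lam [Lam_gt0 Hsol]] := lipschitz_solutions.
pose F r := exists k0, forall k, (k0 <= k)%N -> forall x, D x ->
  q (iter (2 ^ k) T x) * r ^+ (2 ^ k) <= q x.
(* Stepping back from [r] to [r - d] turns the bound at [r] into one with a factor
   [(1 - d / r)^(2^k)], eventually below 1/8. The jump from there to [r + d] has length [2 * d], as
   much as [root_step] allows. *)
pose d := (8 * Lam)^-1; have d_gt0 : 0 < d by rewrite invr_gt0 mulr_gt0.
have Ld : Lam * (2 * d) = 4^-1 by rewrite /d; field; lra.
have Fstep r r' : 0 < r -> F r -> r' <= r + d -> 0 <= r' -> r' <= rho -> F r'.
  move=> r_gt0 [k0 Hk0] r'r r'_ge0 r'rho.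
  have [r'le|rr'] := leP r' r.
    exists k0 => k /Hk0 H x Dx; apply: le_trans (H x Dx).
    apply: ler_wpM2l; first exact: q_ge0 (D_Tn _ Dx).
    by rewrite lerXn2r // nnegrE ltW.
  pose s := Num.max 0 (r - d).
  have s_ge0 : 0 <= s by rewrite le_max lexx.
  have s_lt : s < r by rewrite gt_max r_gt0 /=; lra.
  have s_ge : r - d <= s by rewrite le_max lexx orbT.
  have sr : 0 <= s / r < 1 by rewrite divr_ge0 ?(ltW r_gt0) //= ltr_pdivrMr // mul1r.
  have e8 : 0 < 8^-1 :> R by rewrite invr_gt0.
  have [n0 Hn0] := power_decay sr e8.
  exists (maxn k0 n0) => k; rewrite geq_max => /andP[/Hk0 H kn0].
  have [Y [Ysol Ylip]] := Hsol k.
  apply: (root_step Ysol Ylip s_ge0) => //; first by lra.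
    by rewrite -Ld; apply: ler_wpM2l; [exact: ltW|lra].
  move=> x Dx; have -> : s = r * (s / r) by rewrite mulrC mulfVK // gt_eqF.
  rewrite exprMn mulrA mulrC; apply: ler_pM; last exact: H.
  - by rewrite exprn_ge0 //; case/andP: sr.
  - by apply: mulr_ge0; [exact: q_ge0 (D_Tn _ Dx)|rewrite exprn_ge0 // ltW].
  - by apply: Hn0; apply: leq_trans kn0 (ltnW (ltn_expl _ _)).
have F0 : exists r0, 0 < r0 /\ F r0.
  exists (tau + 1)^-1; have t1 : 0 < tau + 1 by rewrite ltr_wpDl.
  split; first by rewrite invr_gt0.
  exists 0%N => k _ x Dx; rewrite exprVn ler_pdivrMr ?exprn_gt0 //.
  apply: le_trans (q_Tn _ Dx) _; rewrite mulrC ler_wpM2l ?q_ge0 //.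
  by rewrite lerXn2r ?nnegrE ?lerDl // ltW.
have [r0 [r0_gt0 Fr0]] := F0.
have Fall j r : 0 < r -> r <= rho -> r <= r0 + d * j%:R -> F r.
  elim: j r => [|j IH] r r_gt0 r_rho rj.
    by apply: Fstep Fr0 _ _ _ => //; lra.
  have [rj'|rj'] := leP r (r0 + d * j%:R); first exact: IH.
  have dj : 0 <= d * j%:R by rewrite mulr_ge0 // ltW.
  apply: (Fstep (r0 + d * j%:R)); [lra|apply: IH; lra| |lra|lra].
  by move: rj; rewrite -natr1; lra.
have [k0 Hk0] : F rho.
  apply: (Fall (Num.bound (rho / d))) => //.
  have := @archi_boundP _ (rho / d); rewrite divr_ge0 ?(ltW d_gt0) ?(ltW rho_gt0) //.
  by move=> /(_ isT); rewrite ltr_pdivrMr // mulrC => /ltW/le_trans; apply; lra.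
have Hn := Hk0 k0 (leqnn _); set n1 := (2 ^ k0)%N in Hn.
have n1_gt0 : (0 < n1)%N by rewrite expn_gt0.
have tr b : 0 <= (tau * rho) ^+ b by rewrite exprn_ge0 // mulr_ge0 // ltW.
(* The power [n1] does not increase [q] at radius [rho], so only the remainder of [n] modulo [n1]
   counts; the sum dominates every remainder. *)
exists (1 + \sum_(b < n1) (tau * rho) ^+ b); split.
  by apply: ltr_pwDl => //; apply: sumr_ge0.
move=> n x Dx; rewrite (divn_eq n n1).
have := ltn_pmod n n1_gt0; move: (n %/ n1)%N (n %% n1)%N => a b bn1.
apply: (@le_trans _ _ (q (iter b T x) * rho ^+ b)).
  elim: a => [|a IH]; first by rewrite mul0n add0n.
  apply: le_trans IH; rewrite mulSn -addnA iterD exprD mulrA.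
  by rewrite ler_wpM2r ?exprn_ge0 ?(ltW rho_gt0) // Hn //; exact: D_Tn.
apply: le_trans (ler_wpM2r _ (q_Tn _ Dx)) _; first by rewrite exprn_ge0 // ltW.
rewrite mulrAC -exprMn ler_wpM2r ?q_ge0 //.
rewrite (bigD1 (Ordinal bn1)) //= addrCA lerDl addr_ge0 //.
by apply: sumr_ge0.
Qed.

End SpectralRadius.

(** * Gelfand theory *)

Section BanachAlgebraTheory.
Variables (R : realType) (A : completeNormedModType R[i]).
Variables (mul : A -> A -> A) (one : A).
Local Notation C := R[i].
Local Open Scope classical_set_scope.

Lemma cauchy_limit (s : nat -> A) :
  (forall e : R, 0 < e -> exists N, forall n, (N <= n)%N -> nm (s n - s N) < e) ->
  exists y, forall e : R, 0 < e ->
    exists N, forall n, (N <= n)%N -> nm (y - s n) < e.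
Proof.
move=> Hs; have cs : cvg (s @ \oo).
  apply/cauchy_cvgP; apply: cauchy_exP => e e_gt0.
  have eR : e = ((complex.Re e)%:C)%C by rewrite RRe_real // gtr0_real.
  have : 0 < complex.Re e by rewrite -ltcR -eR.
  move=> /Hs[N HN]; exists (s N); exists N => // n /= Nn.
  by rewrite -ball_normE /ball_ /= eR nm_ltC nmBC HN.
exists (lim (s @ \oo)) => e e_gt0.
have e_gt0' : 0 < (e%:C)%C :> C by rewrite ltcR.
have /cvgrPdist_lt /(_ _ e_gt0') [N _ HN] := cs.
by exists N => n /HN /=; rewrite nm_ltC.
Qed.

Hypothesis hA : comBanachAlg mul one.

Lemma mulx_lin (a : C) x y z : mul x (a *: y + z) = a *: mul x y + mul x z.
Proof. by rewrite !(Defs.mulC hA x) (Defs.mulDl hA). Qed.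

Lemma mulx0 x : mul x 0 = 0.
Proof. by have := mulx_lin (-1) x 0 0; rewrite scaler0 addr0 scaleN1r addNr. Qed.

Lemma mulxD x y z : mul x (y + z) = mul x y + mul x z.
Proof. by rewrite -[y]scale1r mulx_lin !scale1r. Qed.

Lemma mulxZ (a : C) x y : mul x (a *: y) = a *: mul x y.
Proof. by rewrite -[a *: y]addr0 mulx_lin mulx0 addr0. Qed.

Lemma mulxB x y z : mul x (y - z) = mul x y - mul x z.
Proof. by rewrite mulxD -scaleN1r mulxZ scaleN1r. Qed.

Lemma mulBx x y z : mul (y - z) x = mul y x - mul z x.
Proof. by rewrite !(Defs.mulC hA _ x) mulxB. Qed.

Lemma mulZx (a : C) x y : mul (a *: x) y = a *: mul x y.
Proof. by rewrite (Defs.mulC hA) // mulxZ (Defs.mulC hA). Qed.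

Lemma mulx1 x : mul x one = x.
Proof. by rewrite (Defs.mulC hA) // mul1x. Qed.

Lemma mulxCA x y z : mul x (mul y z) = mul y (mul x z).
Proof. by rewrite !(Defs.mulA hA) (Defs.mulC hA x). Qed.

Lemma nm_mul x y : nm (mul x y) <= nm x * nm y.
Proof. by rewrite -lecR rmorphM /= !nmE (norm_mul hA). Qed.

Definition alg_pow (g : A) n := iter n (mul g) one.

Lemma nm_pow d n : nm (alg_pow d n) <= nm d ^+ n * nm one.
Proof.
elim: n => [|n IH]; first by rewrite mul1r.
apply: le_trans (nm_mul _ _) _; rewrite exprS -mulrA.
by rewrite ler_wpM2l // nm_ge0.
Qed.

(** The Neumann series, with [nm one] carried along because it is not assumed to be 1. *)
Lemma neumann x : nm (one - x) < 1 -> exists y, mul y x = one.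
Proof.
set d := one - x => d_lt1; have d_ge0 := nm_ge0 d.
pose s n := \sum_(i < n) alg_pow d i.
have sx n : mul x (s n) = one - alg_pow d n.
  elim: n => [|n IH]; first by rewrite /s big_ord0 mulx0 subrr.
  rewrite /s big_ord_recr /= mulxD -/(s n) IH.
  have -> : x = one - d by rewrite /d subKr.
  by rewrite mulBx (mul1x hA) // addrA subrK.
have s_tail N k : nm (s (N + k)%N - s N) * (1 - nm d) <= nm d ^+ N * nm one * (1 - nm d ^+ k).
  elim: k => [|k IH]; first by rewrite addn0 !subrr nm0 mul0r mulr0.
  rewrite addnS /s big_ord_recr /= -/(s _) addrAC.
  have h := nmD (s (N + k)%N - s N) (alg_pow d (N + k)).
  have h' := nm_pow d (N + k).
  have h2 : nm (s (N + k)%N - s N + alg_pow d (N + k)) * (1 - nm d) <=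
    (nm (s (N + k)%N - s N) + nm d ^+ (N + k) * nm one) * (1 - nm d).
    by rewrite ler_wpM2r ?subr_ge0 ?(ltW d_lt1) //; lra.
  apply: le_trans h2 _; rewrite mulrDl; move: IH; rewrite exprD exprS; lra.
have d1 : 0 < 1 - nm d by rewrite subr_gt0.
have d01 : 0 <= nm d < 1 by rewrite d_ge0.
have c1 : 0 < nm one + 1 by rewrite ltr_wpDl // nm_ge0.
have [e e_gt0|y Hy] := @cauchy_limit s.
  have e1 : 0 < e * (1 - nm d) / (nm one + 1) / 2.
    by rewrite !divr_gt0 // mulr_gt0.
  have [N HN] := power_decay d01 e1; exists N => n Nn.
  rewrite -(subnKC Nn) -(ltr_pM2r d1); apply: le_lt_trans (s_tail _ _) _.
  have h1 : nm d ^+ N * (nm one + 1) <= e * (1 - nm d) / 2.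
    rewrite -ler_pdivlMr // mulrAC; exact: HN.
  have h2 : 0 <= nm d ^+ N by rewrite exprn_ge0.
  have h3 : 0 <= nm d ^+ (n - N) by rewrite exprn_ge0.
  have h4 : nm d ^+ N * nm one * (1 - nm d ^+ (n - N)) <= nm d ^+ N * nm one.
    by rewrite ler_piMr ?mulr_ge0 ?nm_ge0 // lerBlDr lerDl.
  have h5 : 0 < e * (1 - nm d) by rewrite mulr_gt0.
  lra.
exists y; apply/eqP; rewrite -subr_eq0; apply/eqP/nm_eq0.
apply/eqP; rewrite eq_le nm_ge0 andbT; apply/ler_addgt0Pl => e e_gt0.
rewrite addr0; have x1 : 0 < nm x + 1 by rewrite ltr_wpDl // nm_ge0.
have e1 : 0 < e / 2 / (nm x + 1) by rewrite !divr_gt0.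
have e2 : 0 < e / 2 / (nm one + 1) by rewrite !divr_gt0.
have [N1 HN1] := Hy _ e1; have [N2 HN2] := power_decay d01 e2.
pose n := maxn N1 N2.
have -> : mul y x - one = mul (y - s n) x - alg_pow d n.
  by rewrite mulBx (Defs.mulC hA (s n)) sx opprB addrAC addrA subrK.
apply: le_trans (nmB _ _) _; have h1 := nm_mul (y - s n) x.
have h2 : nm (y - s n) * (nm x + 1) <= e / 2.
  by rewrite -ler_pdivlMr // ltW // HN1 // leq_maxl.
have h3 := nm_pow d n.
have h4 : nm d ^+ n * (nm one + 1) <= e / 2.
  by rewrite -ler_pdivlMr // HN2 // leq_maxr.
have h5 := nm_ge0 (y - s n); have h6 : 0 <= nm d ^+ n by rewrite exprn_ge0.
lra.
Qed.

Definition is_ideal (I : set A) :=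
  [/\ I 0, forall x y, I x -> I y -> I (x + y) & forall a x, I x -> I (mul a x)].

Lemma ideal_scale I (a : C) x : is_ideal I -> I x -> I (a *: x).
Proof. by move=> [_ _ HM] Ix; rewrite -(mul1x hA x) -mulZx; exact: HM. Qed.

Lemma ideal_opp I x : is_ideal I -> I x -> I (- x).
Proof. by move=> HI Ix; rewrite -scaleN1r; exact: ideal_scale. Qed.

(** Zorn's lemma. The last clause, that [A / I] is a field, is the form in which maximality is
    used. *)
Lemma maximal_ideal x : (forall y, mul y x <> one) ->
  exists I, [/\ is_ideal I, I x, ~ I one &
    forall z, ~ I z -> exists y, I (one - mul y z)].
Proof.
move=> xninv.
pose P (J : set A) := J = set0 \/ [/\ is_ideal J, J x & ~ J one].
have [F FP Ftot|I [PI maxI]] := @Zorn_bigcup A P.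
  have [[J0 FJ0 [z0 Jz0]]|allE] := pselect (exists2 J, F J & J !=set0); last first.
    left; rewrite -subset0 => z [J FJ Jz]; exfalso; apply: allE.
    by exists J => //; exists z.
  have HJ J z : F J -> J z -> [/\ is_ideal J, J x & ~ J one].
    by move=> FJ Jz; case: (FP _ FJ) => // J_0; rewrite J_0 in Jz.
  right; split.
  - split.
    + by exists J0 => //; case: (HJ _ _ FJ0 Jz0) => -[].
    + move=> a b [J FJ Ja] [K FK Kb].
      case: (Ftot _ _ FJ FK) => [JK|KJ].
        exists K => //; case: (HJ _ _ FK Kb) => -[_ HD _] _ _.
        by apply: HD => //; exact: JK.
      exists J => //; case: (HJ _ _ FJ Ja) => -[_ HD _] _ _.
      by apply: HD => //; exact: KJ.
    + move=> a b [J FJ Jb]; exists J => //.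
      by case: (HJ _ _ FJ Jb) => -[_ _ HM] _ _; exact: HM.
  - by exists J0 => //; case: (HJ _ _ FJ0 Jz0).
  - by move=> [J FJ J1]; case: (HJ _ _ FJ J1).
case: PI => [I0|[HI Ix I1]].
  exfalso; apply: (maxI [set mul y x | y in setT]).
    rewrite I0; split; first by move=> ? [].
    by move=> /(_ (mul one x)); apply; exists one.
  right; split.
  - split.
    + by exists 0 => //; rewrite (Defs.mulC hA) // mulx0.
    + move=> _ _ [a _ <-] [b _ <-]; exists (a + b) => //.
      by rewrite !(Defs.mulC hA _ x) mulxD.
    + by move=> a _ [b _ <-]; exists (mul a b) => //; rewrite (Defs.mulA hA).
  - by exists one => //; rewrite (mul1x hA).
  - by move=> [y _]; exact: xninv.
exists I; split=> // z nIz; apply: contrapT => noy.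
have [I_0 ID IM] := HI.
apply: (maxI [set t | exists a y, I a /\ t = a + mul y z]).
  split; first by move=> t It; exists t, 0; rewrite (Defs.mulC hA) mulx0 addr0.
  move=> /(_ z); rewrite /= => H; apply: nIz; apply: H.
  by exists 0, one; rewrite (mul1x hA) // add0r.
right; split.
- split.
  + by exists 0, 0; rewrite (Defs.mulC hA) mulx0 addr0.
  + move=> _ _ [a [y [Ia ->]]] [b [y' [Ib ->]]]; exists (a + b), (y + y').
    by split; [exact: ID|rewrite addrACA !(Defs.mulC hA _ z) mulxD].
  + move=> c _ [a [y [Ia ->]]]; exists (mul c a), (mul c y).
    by split; [exact: IM|rewrite mulxD (Defs.mulA hA)].
- by exists x, 0; rewrite (Defs.mulC hA) mulx0 addr0.
- by move=> [a [y [Ia ay]]]; apply: noy; exists y; rewrite ay addrK.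
Qed.

(** * The quotient by a proper ideal *)

Section Quotient.
Variable I : set A.
Hypothesis HI : is_ideal I.
Hypothesis I1 : ~ I one.

(** The quotient norm read on representatives. As a seminorm it already fits the spectral radius
    bound, so closedness of [I] does not have to be established. *)
Definition quot_nm x : R := inf [set nm (x + i) | i in I].

Let quot_inf x : has_inf [set nm (x + i) | i in I].
Proof.
have [I0 _ _] := HI; split; first by exists (nm (x + 0)), 0.
by exists 0 => _ [i _ <-]; exact: nm_ge0.
Qed.

Lemma quot_nm_le x i : I i -> quot_nm x <= nm (x + i).
Proof. by move=> Ii; apply: ge_inf; [case: (quot_inf x)|exists i]. Qed.

Lemma quot_nm_ge x c : (forall i, I i -> c <= nm (x + i)) -> c <= quot_nm x.
Proof.
move=> H; apply: lb_le_inf; first by case: (quot_inf x).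
by move=> _ [i Ii <-]; exact: H.
Qed.

Lemma quot_nm_ge0 x : 0 <= quot_nm x.
Proof. by apply: quot_nm_ge => i _; exact: nm_ge0. Qed.

Lemma quot_nm_approx x e : 0 < e -> exists2 i, I i & nm (x + i) < quot_nm x + e.
Proof.
move=> e0; have [_ [i Ii <-] lt_i] := inf_adherent e0 (quot_inf x).
by exists i.
Qed.

Lemma quot_nmD x y : quot_nm (x + y) <= quot_nm x + quot_nm y.
Proof.
apply/ler_addgt0Pl => e e_gt0; have e2 : 0 < e / 2 by lra.
have [i Ii hi] := quot_nm_approx x e2; have [j Ij hj] := quot_nm_approx y e2.
have [_ ID _] := HI; have h1 := quot_nm_le (x + y) (ID _ _ Ii Ij).
have h2 := nmD (x + i) (y + j); rewrite addrACA in h2; lra.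
Qed.

Lemma quot_nmZ (a : C) x : quot_nm (a *: x) <= nm a * quot_nm x.
Proof.
apply/ler_addgt0Pl => e e_gt0.
have a1 : 0 < nm a + 1 by rewrite ltr_wpDl // nm_ge0.
have e2 : 0 < e / (nm a + 1) by rewrite divr_gt0.
have [i Ii hi] := quot_nm_approx x e2.
have h1 := quot_nm_le (a *: x) (ideal_scale a HI Ii).
rewrite -scalerDr nmZ in h1; apply: le_trans h1 _.
have h2 : nm a * nm (x + i) <= nm a * (quot_nm x + e / (nm a + 1)).
  by rewrite ler_wpM2l ?nm_ge0 // ltW.
have h3 : nm a * (e / (nm a + 1)) <= e.
  by rewrite mulrA ler_pdivrMr // mulrC ler_pM2l // lerDl.
lra.
Qed.

Lemma quot_nmM x y : quot_nm (mul x y) <= quot_nm x * quot_nm y.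
Proof.
have [_ ID IM] := HI.
have h i j : I i -> I j -> quot_nm (mul x y) <= nm (x + i) * nm (y + j).
  move=> Ii Ij; apply: le_trans (nm_mul _ _).
  have -> : mul (x + i) (y + j) = mul x y + (mul y i + mul (x + i) j).
    by rewrite mulxD addrA; congr (_ + _); rewrite (Defs.mulC hA) // mulxD (Defs.mulC hA x).
  by apply: quot_nm_le; apply: ID; exact: IM.
have h' i : I i -> quot_nm (mul x y) <= nm (x + i) * quot_nm y.
  move=> Ii; have [xi0|xi0] := eqVneq (nm (x + i)) 0.
    have [I0 _ _] := HI; have := h _ _ Ii I0; rewrite xi0 !mul0r //.
  have xi : 0 < nm (x + i) by rewrite lt_neqAle eq_sym xi0 nm_ge0.
  rewrite mulrC -ler_pdivrMr //; apply: quot_nm_ge => j Ij.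
  by rewrite ler_pdivrMr // mulrC; exact: h.
have [y0|y0] := eqVneq (quot_nm y) 0.
  have [I0 _ _] := HI; have := h' _ I0; rewrite y0 !mulr0 //.
have yi : 0 < quot_nm y by rewrite lt_neqAle eq_sym y0 quot_nm_ge0.
rewrite -ler_pdivrMr //; apply: quot_nm_ge => i Ii.
by rewrite ler_pdivrMr //; exact: h'.
Qed.

Lemma quot_nm_ideal x : I x -> quot_nm x = 0.
Proof.
move=> Ix; apply/eqP; rewrite eq_le quot_nm_ge0 andbT.
by have := quot_nm_le x (ideal_opp HI Ix); rewrite subrr nm0.
Qed.

(** If [nm (one + i) < 1] with [i] in [I], the Neumann series makes [- i] invertible, which puts
    [one] in [I]. *)
Lemma quot_nm_one : 1 <= quot_nm one.
Proof.
apply: quot_nm_ge => i Ii; rewrite leNgt; apply/negP => lt1.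
have [|y Hy] := @neumann (- i); first by rewrite opprK.
by apply: I1; rewrite -Hy; have [_ _ IM] := HI; apply: IM; exact: ideal_opp.
Qed.

(* Gelfand-Mazur for the field [A / I]. *)
Lemma gelfand_mazur x : (forall z, ~ I z -> exists y, I (one - mul y z)) ->
  exists z : C, I (x - z *: one).
Proof.
move=> Iinv; apply: contrapT => noz.
have xz z : ~ I (x - z *: one) by move=> H; apply: noz; exists z.
have inv z : exists y, I (one - mul y (one - z *: x)).
  have [->|z0] := eqVneq z 0.
    by exists one; rewrite scale0r subr0 mulx1 subrr; case: HI.
  apply: Iinv => H; apply: (xz z^-1).
  have -> : x - z^-1 *: one = (- z^-1) *: (one - z *: x).
    by rewrite scalerBr scalerA mulNr mulVf // !scaleNr scale1r opprK addrC.
  exact: ideal_scale.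
have [y Hy] : exists y, I (one - mul y x).
  by apply: Iinv; have := xz 0; rewrite scale0r subr0.
have below y' z v : I (one - mul y' z) -> quot_nm v <= quot_nm y' * quot_nm (mul z v).
  move=> Hy'; apply: le_trans (quot_nmM _ _).
  have Iv : I (mul v (one - mul y' z)) by have [_ _ IM] := HI; exact: IM.
  have := quot_nmD (mul y' (mul z v)) (mul v (one - mul y' z)).
  rewrite (quot_nm_ideal Iv) addr0; congr (quot_nm _ <= _).
  by rewrite mulxB mulx1 (Defs.mulC hA v) -(Defs.mulA hA) subrKC.
have PE z v : v - z *: mul x v = mul (one - z *: x) v.
  by rewrite mulBx (mul1x hA) mulZx.
(* Since [one - z *: x] is invertible modulo [I] for every [z], the powers [x^n] decay at any
   geometric rate, while the inverse [y] of [x] forces [quot_nm one <= quot_nm y ^+ n * quot_nm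
   (x^n)]. A radius exceeding [quot_nm y] makes the two incompatible. *)
pose rho := 2 * quot_nm y + 1.
have qy := quot_nm_ge0 y.
have rho_gt0 : 0 < rho by rewrite /rho; lra.
have [||K [K_gt0 HK]] := @spectral_radius_bound R A (fun _ => True) quot_nm
  (mul x) (quot_nm x) rho (fun _ _ _ _ => Logic.I) (fun _ _ _ => Logic.I)
  (fun v _ => quot_nm_ge0 v) (fun u v _ _ => quot_nmD u v)
  (fun a v _ => quot_nmZ a v) (fun a u v => mulx_lin a x u v)
  (fun _ _ => Logic.I) (quot_nm_ge0 x) (fun v _ => quot_nmM x v) rho_gt0.
- move=> z _; have [y' Hy'] := inv z; exists (quot_nm y') => v _.
  by rewrite PE; exact: below.
- move=> z _ v _; have [y' Hy'] := inv z; exists (mul y' v); split=> //.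
  apply: quot_nm_ideal; rewrite PE (mulxCA _ y') -[X in _ - X](mul1x hA).
  rewrite (Defs.mulA hA) -mulBx (Defs.mulC hA); have [_ _ IM] := HI; apply: IM.
  by rewrite -opprB; exact: ideal_opp.
have lower n : quot_nm one <= quot_nm y ^+ n * quot_nm (alg_pow x n).
  elim: n => [|n IH]; first by rewrite mul1r.
  apply: le_trans IH _; rewrite exprSr -mulrA ler_wpM2l ?exprn_ge0 //.
  exact: below.
have a01 : 0 <= quot_nm y / rho < 1.
  by rewrite divr_ge0 ?(ltW rho_gt0) //= ltr_pdivrMr // mul1r /rho; lra.
have e_gt0 : 0 < (2 * K)^-1 by rewrite invr_gt0 mulr_gt0.
have [n Hn] := power_decay a01 e_gt0.
have q1 := quot_nm_one.
have h1 := lower n; have h2 := HK n one Logic.I.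
have h3 : quot_nm y ^+ n * (2 * K) <= rho ^+ n.
  have := Hn n (leqnn _); rewrite exprMn exprVn ler_pdivrMr ?exprn_gt0 //.
  by rewrite mulrC ler_pdivlMr ?mulr_gt0.
have h4 : 0 <= quot_nm (alg_pow x n) by exact: quot_nm_ge0.
have h5 := ler_wpM2r h4 h3; rewrite mulrC in h2.
have h6 : quot_nm y ^+ n * (2 * K) * quot_nm (alg_pow x n) <= K * quot_nm one.
  by apply: le_trans h5 _.
have h7 : 2 * K * quot_nm one <= K * quot_nm one.
  have K2 : 0 <= 2 * K by rewrite mulr_ge0 // ltW.
  have := ler_wpM2l K2 h1; lra.
have h8 : K * 1 <= K * quot_nm one by rewrite ler_wpM2l // ltW.
lra.
Qed.

End Quotient.

(** The character sends [u] to the scalar congruent to [u] modulo a maximal ideal containing [x];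
    uniqueness of this scalar gives linearity and multiplicativity. *)
Lemma character_of_noninvertible x : (forall y, mul y x <> one) ->
  exists m : character mul one, m x = 0.
Proof.
move=> /maximal_ideal[I [HI Ix I1 Iinv]].
have /choice[f Hf] : forall u, exists z : C, I (u - z *: one).
  by move=> u; exact: gelfand_mazur.
have [_ ID IM] := HI.
have uniq u z z' : I (u - z *: one) -> I (u - z' *: one) -> z = z'.
  move=> Iz Iz'; apply/eqP; rewrite -subr_eq0; apply: contrapT => /negP nz.
  apply: I1; have := ideal_scale (z - z')^-1 HI (ID _ _ Iz' (ideal_opp HI Iz)).
  by rewrite opprB [u - _ + _]addrC addrA subrK -scalerBl scalerA mulVf // scale1r.
have f_lin (a : C) u v : f (a *: u + v) = a * f u + f v.
  apply: uniq (Hf _) _; rewrite scalerDl opprD addrACA -scalerA -scalerBr.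
  by apply: ID => //; exact: ideal_scale.
have f_mul u v : f (mul u v) = f u * f v.
  apply: uniq (Hf _) _.
  have -> : mul u v - (f u * f v) *: one =
      mul u (v - f v *: one) + f v *: (u - f u *: one).
    by rewrite mulxB mulxZ mulx1 scalerBr addrA subrK scalerA mulrC.
  by apply: ID; [exact: IM|exact: ideal_scale].
have f_one : f one = 1.
  by apply: uniq (Hf _) _; rewrite scale1r subrr; case: HI.
exists (Character f_lin f_mul f_one) => /=.
by apply: uniq (Hf _) _; rewrite scale0r subr0.
Qed.

Section Characters.
Implicit Type m : character mul one.

Lemma char_lin m (a : C) x y : m (a *: x + y) = a * m x + m y.
Proof. by case: m. Qed.

Lemma charM m x y : m (mul x y) = m x * m y.
Proof. by case: m. Qed.

Lemma char1 m : m one = 1.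
Proof. by case: m. Qed.

Lemma char0 m : m 0 = 0.
Proof. by have := char_lin m (-1) 0 0; rewrite scaler0 addr0 mulN1r addNr. Qed.

Lemma charZ m (a : C) x : m (a *: x) = a * m x.
Proof. by rewrite -[a *: x]addr0 char_lin char0 addr0. Qed.

Lemma charB m x y : m (x - y) = m x - m y.
Proof. by rewrite addrC -scaleN1r char_lin mulN1r addrC. Qed.

Lemma char_pow m x n : m (alg_pow x n) = m x ^+ n.
Proof. by elim: n => [|n IH]; [exact: char1|rewrite exprS -IH -charM]. Qed.

Lemma char_ext m m' : (forall x, m x = m' x) -> m = m'.
Proof.
case: m m' => [f f1 f2 f3] [g g1 g2 g3] /= /funext fg; case: _ / fg in g1 g2 g3 *.
by congr Character; exact: Prop_irrelevance.
Qed.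

(** Automatic continuity: if [nm x < nm (m x)], the Neumann series inverts [one - (m x)^-1 *: x],
    although [m] kills it. *)
Lemma char_bound m x : nm (m x) <= nm x.
Proof.
rewrite leNgt; apply/negP => lt.
have mx0 : m x != 0.
  by apply/negP => /eqP mx0; move: lt; rewrite mx0 nm0 ltNge nm_ge0.
have [|y Hy] := @neumann (one - (m x)^-1 *: x).
  rewrite subKr nmZ nmV mulrC ltr_pdivrMr ?mul1r //.
  exact: le_lt_trans (nm_ge0 _) lt.
have := congr1 m Hy; rewrite charM charB charZ !char1 mulVf // subrr mulr0.
by move/eqP; rewrite eq_sym oner_eq0.
Qed.

(** For [nm z <= 1 / (2 B)] no character annihilates [one - z *: g], so it is invertible. The factor
    2 keeps the closed disc inside the region of invertibility. *)
Lemma pow_growth g (B : R) : 0 < B -> (forall m, nm (m g) <= B) ->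
  exists K, 0 < K /\ forall n, nm (alg_pow g n) <= K * (2 * B) ^+ n.
Proof.
move=> B_gt0 Hg; pose rho := (2 * B)^-1.
have B2 : 0 < 2 * B by rewrite mulr_gt0.
have rho_gt0 : 0 < rho by rewrite invr_gt0.
have inv z : nm z <= rho -> exists y, mul y (one - z *: g) = one.
  move=> zr; apply: contrapT => noy.
  have [|m] := @character_of_noninvertible (one - z *: g).
    by move=> y Hy; apply: noy; exists y.
  rewrite charB char1 charZ => /eqP; rewrite subr_eq0 => /eqP /(congr1 (@nm R _)).
  rewrite nm1 nmM => H.
  have h1 : nm z * nm (m g) <= rho * B by apply: ler_pM; rewrite ?nm_ge0.
  have h2 : rho * B = 2^-1 by rewrite /rho; field; rewrite gt_eqF.
  lra.
have PE z v : v - z *: mul g v = mul (one - z *: g) v.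
  by rewrite mulBx (mul1x hA) mulZx.
have [||K [K_gt0 HK]] := @spectral_radius_bound R A (fun _ => True) (@nm R A)
  (mul g) (nm g) rho (fun _ _ _ _ => Logic.I) (fun _ _ _ => Logic.I)
  (fun v _ => nm_ge0 v) (fun u v _ _ => nmD u v)
  (fun a v _ => ltac:(by rewrite nmZ)) (fun a u v => mulx_lin a g u v)
  (fun _ _ => Logic.I) (nm_ge0 g) (fun v _ => nm_mul g v) rho_gt0.
- move=> z /inv[y Hy]; exists (nm y) => v _.
  by rewrite PE; apply: le_trans (nm_mul _ _); rewrite (Defs.mulA hA) Hy (mul1x hA).
- move=> z /inv[y Hy] v _; exists (mul y v); split=> //.
  by rewrite PE mulxCA (Defs.mulA hA) Hy (mul1x hA) subrr nm0.
exists (K * (nm one + 1)); split; first by rewrite mulr_gt0 // ltr_wpDl // nm_ge0.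
move=> n; have := HK n one Logic.I.
rewrite exprVn ler_pdivrMr ?exprn_gt0 // => /le_trans; apply.
rewrite ler_wpM2r ?exprn_ge0 ?(ltW B2) // ler_wpM2l ?(ltW K_gt0) // lerDl //.
Qed.

End Characters.
End BanachAlgebraTheory.

(** * Compactness of the maximal ideal space and the Shilov boundary *)

Section GelfandSpace.
Variables (R : realType) (A : completeNormedModType R[i]).
Variables (mul : A -> A -> A) (one : A).
Local Notation C := R[i].
Local Notation chr := (character mul one).
Local Open Scope classical_set_scope.

Lemma ultra_limit (T : Type) (G : set_system T) (u : T -> R) (b : R) :
  UltraFilter G -> (forall s, `|u s| <= b) ->
  exists l, forall e, 0 < e -> G [set s | `|u s - l| < e].
Proof.
move=> UG ub; have PG : ProperFilter G := @ultra_proper _ _ UG.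
have Fb : (u @ G) `[- b, b].
  by apply: (@filterS _ G _ setT); [move=> s _ /=; rewrite in_itv /= -ler_norml|exact: filterT].
have [p [_ cl]] := @segment_compact R (- b) b _ _ Fb.
exists p => e e_gt0.
have [//|nG] := in_ultra_setVsetC [set s | `|u s - p| < e] UG.
have nB : (u @ G) (~` ball p e).
  apply: (@filterS _ G _ _ _ _ nG) => s /= h hs; apply: h.
  by rewrite distrC; exact: hs.
by have [x [nx xp]] := cl _ _ nB (nbhsx_ballx p e e_gt0).
Qed.

Hypothesis hA : comBanachAlg mul one.

(** Compactness of the Gelfand space: along an ultrafilter refining [F] the values at each [f] are
    bounded by [nm f], hence converge, and the algebraic identities pass to the limit. *)
Lemma char_cluster (F : set_system chr) : ProperFilter F ->
  exists m : chr, forall S, F S -> gelfand_closure S m.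
Proof.
move=> PF; have [G [UG FG]] := ultraFilterLemma PF.
have PG : ProperFilter G := @ultra_proper _ _ UG.
have /choice[re Hre] : forall f : A, exists l, forall e, 0 < e ->
    G [set s : chr | `|complex.Re (s f) - l| < e].
  move=> f; apply: (@ultra_limit _ G _ (nm f)) => s.
  exact: le_trans (nm_Re _) (char_bound hA _ _).
have /choice[im Him] : forall f : A, exists l, forall e, 0 < e ->
    G [set s : chr | `|complex.Im (s f) - l| < e].
  move=> f; apply: (@ultra_limit _ G _ (nm f)) => s.
  exact: le_trans (nm_Im _) (char_bound hA _ _).
pose m f : C := (re f +i* im f)%C.
have Hm f e : 0 < e -> G [set s : chr | nm (s f - m f) < e].
  move=> e_gt0; have e2 : 0 < e / 2 by lra.
  apply: filterS (filterI (Hre f _ e2) (Him f _ e2)) => s /= [h1 h2].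
  apply: le_lt_trans (nm_ReIm _) _.
  have -> : complex.Re (s f - m f) = complex.Re (s f) - re f by case: (s f).
  have -> : complex.Im (s f - m f) = complex.Im (s f) - im f by case: (s f).
  lra.
have small (z : C) K : 0 <= K ->
    (forall e, 0 < e -> nm z <= K * e) -> z = 0.
  move=> K_ge0 H; apply: nm_eq0; apply/eqP; rewrite eq_le nm_ge0 andbT.
  apply/ler_addgt0Pl => e e_gt0; rewrite addr0.
  have K1 : 0 < K + 1 by lra.
  have := H (e / (K + 1)); rewrite divr_gt0 // => /(_ isT)/le_trans; apply.
  by rewrite mulrA ler_pdivrMr // mulrC ler_pM2l // lerDl.
have m_lin (a : C) x y : m (a *: x + y) = a * m x + m y.
  apply/eqP; rewrite -subr_eq0; apply/eqP.
  apply: (small _ (2 + nm a)) => [|e e_gt0].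
    by rewrite addr_ge0 // nm_ge0.
  have [s [[h1 h2] h3]] := filter_ex (filterI
    (filterI (Hm x e e_gt0) (Hm y e e_gt0)) (Hm (a *: x + y) e e_gt0)).
  have -> : m (a *: x + y) - (a * m x + m y) =
      a * (s x - m x) + (s y - m y) - (s (a *: x + y) - m (a *: x + y)).
    by rewrite char_lin; ring.
  have h4 := nmB (a * (s x - m x) + (s y - m y)) (s (a *: x + y) - m (a *: x + y)).
  have h5 := nmD (a * (s x - m x)) (s y - m y).
  have h6 : nm (a * (s x - m x)) <= nm a * e.
    by rewrite nmM ler_wpM2l ?nm_ge0 // ltW.
  move: h1 h2 h3 => /= h1 h2 h3; lra.
have m_mul x y : m (mul x y) = m x * m y.
  apply/eqP; rewrite -subr_eq0; apply/eqP.
  apply: (small _ (1 + nm x + nm (m y))) => [|e e_gt0].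
    by rewrite !addr_ge0 // nm_ge0.
  have [s [[h1 h2] h3]] := filter_ex (filterI
    (filterI (Hm x e e_gt0) (Hm y e e_gt0)) (Hm (mul x y) e e_gt0)).
  have -> : m (mul x y) - m x * m y =
      s x * (s y - m y) + (s x - m x) * m y - (s (mul x y) - m (mul x y)).
    by rewrite charM; ring.
  have h4 := nmB (s x * (s y - m y) + (s x - m x) * m y) (s (mul x y) - m (mul x y)).
  have h5 := nmD (s x * (s y - m y)) ((s x - m x) * m y).
  have h6 : nm (s x * (s y - m y)) <= nm x * e.
    by rewrite nmM ler_pM ?nm_ge0 ?(char_bound hA) // ltW.
  have h7 : nm ((s x - m x) * m y) <= e * nm (m y).
    by rewrite nmM ler_wpM2r ?nm_ge0 // ltW.
  move: h1 h2 h3 => /= h1 h2 h3; lra.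
have m_one : m one = 1.
  apply/eqP; rewrite -subr_eq0; apply/eqP.
  apply: (small _ 1) => // e e_gt0; have [s] := filter_ex (Hm one e e_gt0).
  by rewrite /= char1 nmBC mul1r => /ltW.
exists (Character m_lin m_mul m_one) => S FS n fs eps eps_gt0.
have GS : G [set s : chr | forall i, nm (s (fs i) - m (fs i)) < eps].
  by apply: filter_forall => i; exact: Hm.
have [s [Ss hs]] := filter_ex (filterI (FG _ FS) GS).
by exists s => // i; rewrite nm_ltC; exact: hs.
Qed.

Lemma gelfand_closure_approx (S : set chr) (m : chr) (f : A) (e : R) :
  gelfand_closure S m -> 0 < e -> exists2 s, S s & nm (s f - m f) < e.
Proof.
move=> cl e_gt0; have [s Ss hs] := cl 1%N (fun=> f) e e_gt0.
by exists s => //; have := hs ord0; rewrite nm_ltC.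
Qed.

Lemma gelfand_closureS (S S' : set chr) : S `<=` S' ->
  gelfand_closure S `<=` gelfand_closure S'.
Proof.
move=> SS' m cl n fs eps e0; have [s Ss hs] := cl n fs eps e0.
by exists s => //; exact: SS'.
Qed.

(** The near-maximal sets [S n] have a cluster point, which is a maximum. Uniform limits of Gelfand
    transforms are allowed so that the elements of [checkA] are covered. *)
Lemma max_attained (E : set chr) (h : chr -> C) : gelfand_closed E -> E !=set0 ->
  (forall e : R, 0 < e -> exists f : A, forall t, E t -> nm (h t - t f) < e) ->
  exists2 b, E b & forall t, E t -> nm (h t) <= nm (h b).
Proof.
move=> Ecl [t0 Et0] happ.
pose V := [set nm (h t) | t in E].
have Vsup : has_sup V.
  split; first by exists (nm (h t0)), t0.
  have [f Hf] := happ 1 ltr01; exists (1 + nm f) => _ [t Et <-].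
  have h1 := nm_tri (h t) (t f); have h2 := Hf t Et; have h3 := char_bound hA t f; lra.
pose r := sup V.
pose S (n : nat) := [set t | E t /\ r - n.+1%:R^-1 < nm (h t)].
pose F := [set X : set chr | exists n, S n `<=` X].
have Snn n : exists t, S n t.
  have n0 : 0 < n.+1%:R^-1 :> R by rewrite invr_gt0.
  by have [_ [t Et <-] lt] := sup_adherent n0 Vsup; exists t.
have PF : ProperFilter F.
  apply: Build_ProperFilter_ex => [X [n SX]|].
    by have [t St] := Snn n; exists t; exact: SX.
  split; first by exists 0%N.
    move=> X Y [n SX] [k SY]; exists (maxn n k) => t [Et ht]; split.
      apply: SX; split=> //; apply: le_lt_trans ht; rewrite lerB // lef_pV2 ?posrE //.
      by rewrite ler_nat ltnS leq_maxl.
    apply: SY; split=> //; apply: le_lt_trans ht; rewrite lerB // lef_pV2 ?posrE //.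
    by rewrite ler_nat ltnS leq_maxr.
  by move=> X Y XY [n SX]; exists n; exact: subset_trans XY.
have [b Hb] := char_cluster PF.
have Eb : E b.
  apply: Ecl; apply: gelfand_closureS (Hb (S 0%N) _); last by exists 0%N.
  by move=> t [].
exists b => // t Et; apply: (@le_trans _ _ r).
  by apply: sup_upper_bound => //; exists t.
apply/ler_addgt0Pl => e e_gt0; have e4 : 0 < e / 4 by lra.
have [f Hf] := happ _ e4.
have [n Hn] : exists n : nat, n.+1%:R^-1 <= e / 4.
  exists (Num.bound (e / 4)^-1); rewrite -[leRHS]invrK lef_pV2 ?posrE ?invr_gt0 //.
  apply: le_trans (ltW (archi_boundP _)) _; first by rewrite invr_ge0 ltW.
  by rewrite ler_nat.
have [|s [Es hs] sb] := @gelfand_closure_approx (S n) b f (e / 4) _ e4.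
  by apply: Hb; exists n.
have h1 := Hf s Es; have h2 := Hf b Eb.
have h3 := nm_tri (h s) (s f); have h4 := nm_tri (s f) (b f).
have h5 := nm_tri (b f) (h b); rewrite (nmBC (b f)) in h5.
move: hs Hn; set d := _^-1 => hs Hn; lra.
Qed.

Definition basic_nbhd (V : set chr) := exists (m0 : chr) n (fs : 'I_n -> A) (eps : R),
  0 < eps /\ V = [set m : chr | forall i, nm (m (fs i) - m0 (fs i)) < eps].

(** These sets are the basic open pieces of the complement of the Shilov boundary. *)
Definition removable (V : set chr) := basic_nbhd V /\
  exists B : set chr, [/\ gelfand_closed B, boundary B & forall m, B m -> ~ V m].

Lemma closed_setD_nbhd (E V : set chr) : basic_nbhd V -> gelfand_closed E ->
  gelfand_closed (E `\` V).
Proof.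
move=> [m0 [n [fs [eps [eps_gt0 ->]]]]] Ecl m cl; split.
  by apply: Ecl; apply: gelfand_closureS cl => t [].
move=> /= Vm; pose d i := eps - nm (m (fs i) - m0 (fs i)).
have d_gt0 i : 0 < d i by rewrite subr_gt0.
(* [D^-1] lies below every slack [d i]; the summand 1 covers the empty family. *)
pose D := 1 + \sum_i (d i)^-1.
have s_ge0 (Q : pred 'I_n) : 0 <= \sum_(i | Q i) (d i)^-1.
  by apply: sumr_ge0 => i _; rewrite invr_ge0 ltW.
have D_gt0 : 0 < D by rewrite ltr_pwDl.
have Dd i : D^-1 <= d i.
  rewrite -[leRHS]invrK lef_pV2 ?posrE ?invr_gt0 // /D (bigD1 i) //=.
  by rewrite addrCA lerDl addr_ge0 //.
have D1 : 0 < D^-1 by rewrite invr_gt0.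
have [s [_ nVs] hs] := cl n fs D^-1 D1; apply: nVs => i /=.
have := hs i; rewrite nm_ltC => h1; have h2 := Dd i; rewrite /d in h2.
have -> : s (fs i) - m0 (fs i) = (s (fs i) - m (fs i)) + (m (fs i) - m0 (fs i)) by ring.
apply: le_lt_trans (nmD _ _) _; lra.
Qed.

(* If [f] peaked off [E `\` V], a high power of [f] would force the whole maximum
   set of [f] into [V], which misses a boundary. *)
Lemma boundary_setD_removable (E V : set chr) : removable V ->
  gelfand_closed E -> boundary E -> boundary (E `\` V).
Proof.
move=> [HV [B [Bcl Bb BV]]] Ecl Eb.
have EVcl := closed_setD_nbhd HV Ecl.
have [m0 [n [fs [eps [eps_gt0 VE]]]]] := HV.
have key (f : A) (r : R) : 0 < r -> (exists2 b, E b & nm (b f) = r) ->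
    (forall m : chr, nm (m f) <= r) ->
    exists2 b, (E `\` V) b & nm (b f) = r.
  move=> r_gt0 [bE EbE bEr] fr; apply: contrapT => nomax.
  have [c [c_ge0 c_lt1 Hc]] : exists c, [/\ 0 <= c, c < 1 &
      forall b, (E `\` V) b -> nm (b f) <= c * r].
    have [[b0 Eb0]|allE] := pselect ((E `\` V) !=set0); last first.
      by exists 0; split=> // b Hb; exfalso; apply: allE; exists b.
    have [||b Hb bmax] := @max_attained (E `\` V) (fun m => m f) EVcl.
    - by exists b0.
    - by move=> e e0; exists f => t _; rewrite subrr nm0.
    exists (nm (b f) / r); split.
    - by rewrite divr_ge0 ?nm_ge0 // ltW.
    - rewrite ltr_pdivrMr // mul1r lt_neqAle fr andbT.
      by apply/negP => /eqP bf; apply: nomax; exists b.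
    - by move=> t /bmax; rewrite divfK // gt_eqF.
  have [b Bb' bmax] := Bb f.
  have br : nm (b f) = r.
    apply/eqP; rewrite eq_le fr /= -bEr.
    by have := bmax bE; rewrite nm_le.
  apply: (BV _ Bb'); rewrite VE => i /=.
  pose x := fs i - m0 (fs i) *: one.
  have xE (m : chr) : m x = m (fs i) - m0 (fs i) by rewrite charB charZ char1 mulr1.
  have x1 : 0 < nm x + 1 by rewrite ltr_wpDl // nm_ge0.
  have c01 : 0 <= c < 1 by rewrite c_ge0.
  have e1 : 0 < eps / 2 / (nm x + 1) by rewrite !divr_gt0.
  have [k Hk] := power_decay c01 e1.
  have rk : 0 < r ^+ k by rewrite exprn_gt0.
  (* On [V] the factor [x] is below [eps]; on [E] off [V] the power of [f] is at most [(c r)^k]. So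
     [nm (m g) < r^k * eps] wherever [g] attains its maximum on [E], hence also at [b], where
     [nm (b f) = r]; this gives [nm (b x) < eps]. *)
  pose g := mul (alg_pow mul one f k) x.
  have gE (m : chr) : nm (m g) = nm (m f) ^+ k * nm (m x).
    by rewrite charM char_pow nmM nmX.
  have [b' Eb' b'max] := Eb g.
  have : nm (b g) < r ^+ k * eps.
    apply: (@le_lt_trans _ _ (nm (b' g))); first by rewrite -nm_le.
    rewrite gE; have [Vb'|nVb'] := pselect (V b').
      apply: (@le_lt_trans _ _ (r ^+ k * nm (b' x))).
        by rewrite ler_wpM2r ?nm_ge0 // lerXn2r ?nnegrE ?nm_ge0 // ltW.
      by rewrite ltr_pM2l // xE; move: Vb'; rewrite VE => /(_ i).
    have h1 : nm (b' f) ^+ k <= c ^+ k * r ^+ k.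
      by rewrite -exprMn lerXn2r ?nnegrE ?nm_ge0 ?mulr_ge0 ?(ltW r_gt0) // Hc.
    have h2 : c ^+ k * (nm x + 1) <= eps / 2.
      by rewrite -ler_pdivlMr // Hk.
    have h3 := char_bound hA b' x.
    have h4 : 0 <= c ^+ k by rewrite exprn_ge0.
    apply: (@le_lt_trans _ _ (c ^+ k * r ^+ k * nm x)).
      by apply: ler_pM; rewrite ?exprn_ge0 ?nm_ge0.
    rewrite mulrAC mulrC ltr_pM2l //; lra.
  by rewrite gE br ltr_pM2l // xE.
have rpos (f : A) : exists b, E b /\ forall m : chr, nm (m f) <= nm (b f).
  by have [b Eb' bmax] := Eb f; exists b; split=> // m; rewrite -nm_le.
have [b1 Eb1] : exists b, (E `\` V) b.
  have [b [Eb' bmax]] := rpos one.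
  have [|||b1 Hb1 _] := key one 1; [by []| | |by exists b1].
    by exists b => //; rewrite char1 nm1.
  by move=> m; rewrite char1 nm1.
move=> f; have [b [Eb' bmax]] := rpos f.
have [b0|b0] := eqVneq (nm (b f)) 0.
  exists b1 => // m; rewrite nm_le (le_trans (bmax m)) // b0 nm_ge0 //.
have [|||b2 Hb2 b2f] := key f (nm (b f)).
- by rewrite lt_neqAle eq_sym b0 nm_ge0.
- by exists b.
- exact: bmax.
by exists b2 => // m; rewrite nm_le b2f.
Qed.

(** Finitely many removals from the whole space. These sets remain closed boundaries and are stable
    under intersection, so they can generate a filter. *)
Inductive reachable : set chr -> Prop :=
| reachableT : reachable setT
| reachableD E V : reachable E -> removable V -> reachable (E `\` V).

Lemma reachableI E E' : reachable E -> reachable E' -> reachable (E `&` E').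
Proof.
move=> rE; elim=> [|E1 V _ IH HV]; first by rewrite setIT.
by rewrite setIDA; exact: reachableD.
Qed.

Lemma gelfand_closed_shilov : gelfand_closed (shilov (mul := mul) (one := one)).
Proof.
by move=> m cl B Bcl Bb; apply: (Bcl); apply: gelfand_closureS cl => t st; exact: st.
Qed.

Hypothesis chr_inh : exists m : chr, True.

Lemma boundary_reachable E : reachable E -> gelfand_closed E /\ boundary E.
Proof.
elim=> [|E1 V _ [E1cl E1b] HV]; last first.
  split; last exact: boundary_setD_removable.
  by apply: closed_setD_nbhd => //; case: HV.
split=> // f; have [m0 _] := chr_inh.
have [||| b _ bmax] := @max_attained setT (fun m => m f).
- by [].
- by exists m0.
- by move=> e e0; exists f => t _; rewrite subrr nm0.
by exists b => // m; rewrite nm_le bmax.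
Qed.

(** Every reachable set meets the maximum set of [f], so these traces have a cluster point [m],
    again a maximum point. If [m] missed a closed boundary [B], a basic neighbourhood of [m]
    disjoint from [B] would be removable, and its complement would belong to the filter that
    clusters at [m]. *)
Theorem boundary_shilov : boundary (shilov (mul := mul) (one := one)).
Proof.
move=> f; pose Ef := [set m : chr | forall m' : chr, nm (m' f) <= nm (m f)].
pose F := [set X : set chr | exists2 E, reachable E & E `&` Ef `<=` X].
have PF : ProperFilter F.
  apply: Build_ProperFilter_ex => [X [E rE EX]|].
    have [_ Eb] := boundary_reachable rE; have [b Eb' bmax] := Eb f.
    by exists b; apply: EX; split=> // m; rewrite -nm_le.
  split.
  - by exists setT => //; exact: reachableT.
  - move=> X Y [E rE EX] [E' rE' EY]; exists (E `&` E'); first exact: reachableI.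
    by move=> t [[Et E't] Eft]; split; [apply: EX|apply: EY].
  - by move=> X Y XY [E rE EX]; exists E => //; exact: subset_trans XY.
have [m Hm] := char_cluster PF.
exists m; last first.
  move=> m'; rewrite nm_le; apply/ler_addgt0Pl => e e_gt0.
  have [|s Es sm] := @gelfand_closure_approx Ef m f e _ e_gt0.
    by apply: Hm; exists setT; [exact: reachableT|move=> t []].
  by have h1 := Es m'; have h2 := nm_tri (s f) (m f); lra.
move=> B Bcl Bb; apply: contrapT => nBm.
have : ~ gelfand_closure B m by move=> /Bcl.
move=> ncl; apply: ncl => n fs eps eps_gt0; apply: contrapT => nos.
pose V := [set m' : chr | forall i, nm (m' (fs i) - m (fs i)) < eps].
have HV : basic_nbhd V by exists m, n, fs, eps.
have rV : removable V.
  split=> //; exists B; split=> // t Bt Vt; apply: nos; exists t => // i.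
  by rewrite nm_ltC; exact: Vt.
have FV : F (~` V).
  by exists (setT `\` V); [apply: reachableD => //; exact: reachableT|move=> t [[]]].
have [s nVs hs] := Hm _ FV n fs eps eps_gt0.
by apply: nVs => i; have := hs i; rewrite nm_ltC.
Qed.

End GelfandSpace.

(** * The map of the maximal ideal space induced by an automorphism *)

Section InducedMap.
Variables (R : realType) (A : completeNormedModType R[i]).
Variables (mul : A -> A -> A) (one : A).
Local Notation C := R[i].
Local Notation chr := (character mul one).
Implicit Types U V : algAut mul one.

Lemma aut_lin U (a : C) x y : U (a *: x + y) = a *: U x + U y.
Proof. by case: U. Qed.

Lemma autM U x y : U (mul x y) = mul (U x) (U y).
Proof. by case: U. Qed.

Lemma aut1 U : U one = one.
Proof. by case: U. Qed.

Lemma aut_inverse U : exists V, cancel U V /\ cancel V U.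
Proof.
have [V UV VU] : bijective U by case: U.
have Uinj := can_inj UV.
have V_lin (a : C) x y : V (a *: x + y) = a *: V x + V y.
  by apply: Uinj; rewrite aut_lin !VU.
have V_mul x y : V (mul x y) = mul (V x) (V y).
  by apply: Uinj; rewrite autM !VU.
have V_one : V one = one by apply: Uinj; rewrite aut1 VU.
by exists (AlgAut V_lin V_mul V_one (Bijective VU UV)).
Qed.

Lemma phiE U (m : chr) x : phi U m x = m (U x).
Proof. by []. Qed.

Lemma phiK U V : cancel V U -> cancel (phi U) (phi V).
Proof. by move=> VU m; apply: char_ext => x; rewrite !phiE VU. Qed.

(** The preimage of a closed boundary under [phi U] is again a closed boundary. *)
Lemma shilov_phi U (t : chr) : shilov t -> shilov (phi U t).
Proof.
have [V [UV VU]] := aut_inverse U.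
move=> st B Bcl Bb; apply: (st (fun m => B (phi U m))).
  move=> m cl; apply: Bcl => n fs eps e0.
  by have [s Bs hs] := cl n (fun i => U (fs i)) eps e0; exists (phi U s).
move=> f; have [b Bb' bmax] := Bb (V f); exists (phi V b); first by rewrite (phiK UV).
by move=> m; have := bmax (phi U m); rewrite !phiE VU.
Qed.

Lemma shilov_iter_phi U n (t : chr) : shilov t -> shilov (iter n (phi U) t).
Proof. by move=> st; elim: n => //= n; exact: shilov_phi. Qed.

End InducedMap.

(** * The uniform algebra and the growth of the weights *)

Section CheckAlgebra.
Variables (R : realType) (A : completeNormedModType R[i]).
Variables (mul : A -> A -> A) (one : A).
Hypothesis hA : comBanachAlg mul one.
Local Notation C := R[i].
Local Notation chr := (character mul one).
Local Notation X := (chr -> C^o).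
Local Open Scope classical_set_scope.
Implicit Types (g h : chr -> C) (U V : algAut mul one).

Lemma checkAP g : checkA g <->
  forall e : R, 0 < e -> exists f : A, forall t, shilov t -> nm (g t - t f) < e.
Proof.
by split=> H e e0; have [f Hf] := H e e0; exists f => t st;
  have := Hf t st; rewrite nm_ltC.
Qed.

Lemma checkA_char (f : A) : checkA (fun t : chr => t f).
Proof. by apply/checkAP => e e0; exists f => t _; rewrite subrr nm0. Qed.

Lemma checkA_eqOnS g h : eqOnS g h -> checkA g -> checkA h.
Proof.
by move=> gh Hg e e0; have [f Hf] := Hg e e0; exists f => t st; rewrite -gh // Hf.
Qed.

Lemma checkA_bounded g : checkA g ->
  exists M : R, 0 <= M /\ forall t, shilov t -> nm (g t) <= M.
Proof.
move=> /checkAP /(_ 1 ltr01) [f Hf]; exists (1 + nm f); split.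
  by rewrite addr_ge0 // nm_ge0.
move=> t st; have h1 := nm_tri (g t) (t f); have h2 := Hf t st.
have h3 := char_bound hA t f; lra.
Qed.

Lemma checkA_lin (a : C) g h : checkA g -> checkA h ->
  checkA (fun t => a * g t + h t).
Proof.
move=> /checkAP Hg /checkAP Hh; apply/checkAP => e e_gt0.
have a1 : 0 < nm a + 1 by rewrite ltr_wpDl // nm_ge0.
have e1 : 0 < e / (2 * (nm a + 1)) by rewrite divr_gt0 // mulr_gt0.
have e2 : 0 < e / 2 by lra.
have [f Hf] := Hg _ e1; have [k Hk] := Hh _ e2; exists (a *: f + k) => t st.
have -> : a * g t + h t - t (a *: f + k) = a * (g t - t f) + (h t - t k).
  by rewrite char_lin; ring.
apply: le_lt_trans (nmD _ _) _; rewrite nmM.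
have h1 : nm a * nm (g t - t f) <= nm a * (e / (2 * (nm a + 1))).
  by rewrite ler_wpM2l ?nm_ge0 // ltW // Hf.
have h2 : nm a * (e / (2 * (nm a + 1))) <= e / 2.
  rewrite mulrA ler_pdivrMr ?mulr_gt0 // mulrA divfK ?pnatr_eq0 //.
  by rewrite mulrC ler_pM2l // lerDl.
have h3 := Hk t st; lra.
Qed.

Lemma checkA_mul g h : checkA g -> checkA h -> checkA (fun t => g t * h t).
Proof.
move=> Dg Dh; have [M [M_ge0 HM]] := checkA_bounded Dg.
move: Dg Dh => /checkAP Hg /checkAP Hh; apply/checkAP => e e_gt0.
have M1 : 0 < 2 * (M + 1) by lra.
have [k Hk] := Hh _ (divr_gt0 e_gt0 M1).
have k1 : 0 < 2 * (nm k + 1) by rewrite mulr_gt0 // ltr_wpDl // nm_ge0.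
have [f Hf] := Hg _ (divr_gt0 e_gt0 k1).
exists (mul f k) => t st.
have -> : g t * h t - t (mul f k) = g t * (h t - t k) + (g t - t f) * t k.
  by rewrite charM; ring.
apply: le_lt_trans (nmD _ _) _; rewrite !nmM.
have h1 : nm (g t) * nm (h t - t k) <= M * (e / (2 * (M + 1))).
  by apply: ler_pM; rewrite ?nm_ge0 ?HM // ltW // Hk.
have h2 : M * (e / (2 * (M + 1))) < e / 2.
  rewrite mulrA ltr_pdivrMr // mulrA divfK ?pnatr_eq0 //.
  by rewrite mulrC ltr_pM2l // ltrDl.
have h3 : nm (g t - t f) * nm (t k) <= e / (2 * (nm k + 1)) * nm k.
  by apply: ler_pM; rewrite ?nm_ge0 ?(char_bound hA) // ltW // Hf.
have h4 : e / (2 * (nm k + 1)) * nm k <= e / 2.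
  rewrite mulrAC ler_pdivrMr // mulrA divfK ?pnatr_eq0 //.
  by rewrite ler_pM2l // lerDl.
lra.
Qed.

Lemma checkA_phi U g : checkA g -> checkA (fun t => g (phi U t)).
Proof.
move=> Hg e e0; have [f Hf] := Hg e e0; exists (U f) => t st.
by have := Hf _ (shilov_phi U st); rewrite phiE.
Qed.

Lemma checkA_iter_phi U g n : checkA g -> checkA (fun t => g (iter n (phi U) t)).
Proof.
move=> Hg; elim: n => // n /(checkA_phi U).
by apply: checkA_eqOnS => t _ /=; rewrite -iterSr.
Qed.

Lemma checkA_exp g n : checkA g -> checkA (fun t => g t ^+ n).
Proof.
move=> Hg; elim: n => [|n IH].
  by apply: checkA_eqOnS (checkA_char one) => t _; rewrite char1.
by apply: checkA_eqOnS (checkA_mul Hg IH) => t _; rewrite exprS.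
Qed.

Hypothesis chr_inh : exists m : chr, True.

Lemma shilov_inh : exists t : chr, shilov t.
Proof. by have [t st _] := boundary_shilov hA chr_inh one; exists t. Qed.

Definition supS g : R := sup [set nm (g t) | t in shilov (mul := mul) (one := one)].

Lemma supS_ub g t : checkA g -> shilov t -> nm (g t) <= supS g.
Proof.
move=> /checkA_bounded[M [_ HM]] st; apply: sup_upper_bound; last by exists t.
split; first by exists (nm (g t)), t.
by exists M => _ [s ss <-]; exact: HM.
Qed.

Lemma supS_le g M : (forall t, shilov t -> nm (g t) <= M) -> supS g <= M.
Proof.
move=> H; apply: ge_sup; last by move=> _ [s ss <-]; exact: H.
by have [t st] := shilov_inh; exists (nm (g t)), t.
Qed.

Lemma supS_ge0 g : checkA g -> 0 <= supS g.
Proof.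
move=> Dg; have [t st] := shilov_inh.
by apply: le_trans (nm_ge0 _) (supS_ub Dg st).
Qed.

Lemma supS_eq g h : eqOnS g h -> supS g = supS h.
Proof.
move=> gh; congr sup; apply/seteqP; split=> _ [t st <-]; exists t => //.
  by rewrite gh.
by rewrite gh.
Qed.

Lemma supS_null g : eqOnS g (fun=> 0) -> supS g = 0.
Proof.
move=> /supS_eq ->; apply/eqP; rewrite eq_le supS_le => [/=|t _]; last by rewrite nm0.
apply: supS_ge0; apply: checkA_eqOnS (checkA_char 0) => t _; exact: char0.
Qed.

Lemma supSD g h : checkA g -> checkA h -> supS (fun t => g t + h t) <= supS g + supS h.
Proof.
move=> Dg Dh; apply: supS_le => t st; apply: le_trans (nmD _ _) _.
by rewrite lerD // supS_ub.
Qed.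

Lemma supSZ (a : C) g : checkA g -> supS (fun t => a * g t) <= nm a * supS g.
Proof.
move=> Dg; apply: supS_le => t st; rewrite nmM.
by rewrite ler_wpM2l ?nm_ge0 // supS_ub.
Qed.

Lemma checkA_scale (a : C) g : checkA g -> checkA (fun t => a * g t).
Proof.
move=> Dg; apply: checkA_eqOnS (checkA_lin a Dg (checkA_char 0)) => t _.
by rewrite char0 addr0.
Qed.

Lemma checkA_add g h : checkA g -> checkA h -> checkA (fun t => g t + h t).
Proof.
by move=> Dg Dh; apply: checkA_eqOnS (checkA_lin 1 Dg Dh) => t _; rewrite mul1r.
Qed.

(** Only the iterates of the constant 1 are kept: for a weighted composition operator they are the
    cocycle of weights. *)
Lemma check_radius (T : X -> X) (tau rho : R) :
  (forall (a : C) (g h : X), T (a *: g + h) = a *: T g + T h) ->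
  (forall g, checkA g -> checkA (T g)) -> 0 <= tau ->
  (forall g, checkA g -> supS (T g) <= tau * supS g) -> 0 < rho ->
  (forall z, nm z <= rho -> exists M, forall g, checkA g ->
     supS g <= M * supS (fun t => g t - z * T g t)) ->
  (forall z, nm z <= rho -> forall g, checkA g ->
     exists2 y, checkA y & eqOnS (fun t => y t - z * T y t) g) ->
  exists K, 0 < K /\ forall n t, shilov t -> nm (iter n T (fun=> 1) t) * rho ^+ n <= K.
Proof.
move=> T_lin DT tau_ge0 qT rho_gt0 below onto.
have [||K [K_gt0 HK]] := @spectral_radius_bound R X
  (fun g => checkA g) supS T tau rho
  (fun g h => @checkA_add g h) (fun a g => @checkA_scale a g) supS_ge0
  (fun g h => @supSD g h) (fun a g => @supSZ a g) T_lin DT tau_ge0 qT rho_gt0.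
- exact: below.
- move=> z zr g Dg; have [y Dy yg] := onto z zr g Dg; exists y; split=> //.
  apply: supS_null => t st.
  by apply: (etrans (congr1 (fun u => u - g t) (yg t st))); exact: subrr.
have D1 : checkA (fun _ : chr => 1 : C).
  by apply: checkA_eqOnS (checkA_char one) => t _; exact: char1.
exists (K * (supS (fun=> 1) + 1)); split.
  by rewrite mulr_gt0 // ltr_wpDl // supS_ge0.
move=> n t st; have Dn : checkA (iter n T (fun=> 1)) by elim: n => //= n; exact: DT.
apply: (@le_trans _ _ (supS (iter n T (fun=> 1)) * rho ^+ n)).
  by rewrite ler_wpM2r ?exprn_ge0 ?(ltW rho_gt0) // supS_ub.
apply: le_trans (HK n _ D1) _.
by rewrite ler_wpM2l ?(ltW K_gt0) // lerDl.
Qed.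

(** * Weighted composition operators and their cocycles *)

Section Weighted.
Variables (U : algAut mul one) (w : A).
Local Notation T := (check_wcomp U w).

Definition weight (n : nat) (t : chr) : C := \prod_(i < n) (iter i (phi U) t) w.

Lemma weightS n t : weight n.+1 t = weight n t * iter n (phi U) t w.
Proof. by rewrite /weight big_ord_recr. Qed.

Lemma iter_check_wcomp n g t :
  iter n T g t = weight n t * g (iter n (phi U) t).
Proof.
elim: n g t => [|n IH] g t; first by rewrite /weight big_ord0 mul1r.
by rewrite iterSr IH /check_wcomp weightS -mulrA -iterS.
Qed.

Lemma checkA_wcomp g : checkA g -> checkA (T g).
Proof.
by move=> Dg; apply: checkA_mul; [exact: checkA_char|exact: checkA_phi].
Qed.

Lemma supS_wcomp g : checkA g -> supS (T g) <= nm w * supS g.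
Proof.
move=> Dg; apply: supS_le => t st; rewrite /check_wcomp nmM.
apply: ler_pM; rewrite ?nm_ge0 ?(char_bound hA) //.
by apply: supS_ub => //; exact: shilov_phi.
Qed.

Lemma check_resolvent (lam : C) : ~ check_spectrum T lam ->
  (exists K, 0 <= K /\
     forall g, checkA g -> supS g <= K * supS (fun t => T g t - lam * g t)) /\
  (forall g, checkA g -> exists2 y, checkA y &
     eqOnS (fun t => T y t - lam * y t) g).
Proof.
move=> /contrapT[S [SD _ [K HK] ST TS]]; split; last first.
  by move=> g Dg; exists (S g); [exact: SD|exact: TS].
exists `|K|; split=> // g Dg.
have Dh : checkA (fun t => T g t - lam * g t).
  apply: checkA_eqOnS (checkA_lin (- lam) Dg (checkA_wcomp Dg)) => t _.
  by rewrite mulNr addrC.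
apply: supS_le => t st; rewrite -(ST g Dg t st).
have Hub s : shilov s ->
    `|T g s - lam * g s| <= ((supS (fun t => T g t - lam * g t))%:C)%C.
  by move=> ss; rewrite nm_leC (supS_ub Dh).
have := HK _ _ Dh Hub t st; rewrite nm_leC => /le_trans; apply.
by rewrite ler_wpM2r ?supS_ge0 // ler_norm.
Qed.

Hypothesis spT : forall lam, check_spectrum T lam -> `|lam| = 1.

Lemma not_check_spectrum (lam : C) : nm lam != 1 -> ~ check_spectrum T lam.
Proof. by move=> l1 /spT l; move: l1; rewrite /nm l eqxx. Qed.

(** For nonzero [z] with [nm z <= rho] the point [z^-1] lies outside the closed unit disc, hence off
    the spectrum, so [1 - z T] is invertible on the whole disc of radius [rho]. *)
Lemma weight_upper (rho : R) : 0 < rho < 1 ->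
  exists K, 0 < K /\ forall n t, shilov t -> nm (weight n t) * rho ^+ n <= K.
Proof.
move=> /andP[rho_gt0 rho_lt1].
have Tz (z : C) : z != 0 -> forall (g : chr -> C) t,
    g t - z * T g t = (- z) * (T g t - z^-1 * g t).
  by move=> z0 g t; field.
have zinv (z : C) : z != 0 -> nm z <= rho -> ~ check_spectrum T z^-1.
  move=> z0 zr; apply: not_check_spectrum.
  rewrite nmV invr_eq1 lt_eqF //; exact: le_lt_trans zr rho_lt1.
have [|||||||K [K_gt0 HK]] := @check_radius (T : X -> X) (nm w) rho.
- by move=> a g h; apply/funext => t; rewrite /check_wcomp /= mulrDr mulrCA.
- exact: checkA_wcomp.
- exact: nm_ge0.
- exact: supS_wcomp.
- exact: rho_gt0.
- move=> z zr; have [->|z0] := eqVneq z 0.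
    exists 1 => g Dg; rewrite mul1r le_eqVlt; apply/orP; left; apply/eqP.
    by apply: supS_eq => t _; rewrite mul0r subr0.
  have [[K [K_ge0 HK]] _] := check_resolvent (zinv z z0 zr).
  exists (K * nm z^-1) => g Dg; apply: le_trans (HK g Dg) _; rewrite -mulrA ler_wpM2l //.
  have D' : checkA (fun t => g t - z * T g t).
    apply: checkA_eqOnS (checkA_lin (- z) (checkA_wcomp Dg) Dg) => t _.
    by rewrite mulNr addrC.
  have -> : supS (fun t => T g t - z^-1 * g t) =
      supS (fun t => (- z^-1) * (g t - z * T g t)).
    by apply: supS_eq => t _; field.
  by apply: le_trans (supSZ _ D') _; rewrite nmN.
- move=> z zr g Dg; have [->|z0] := eqVneq z 0.
    by exists g => // t _; rewrite mul0r subr0.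
  have [_ onto] := check_resolvent (zinv z z0 zr).
  have [y Dy yg] := onto _ (checkA_scale (- z^-1) Dg); exists y => // t st.
  by rewrite Tz // (yg t st); field.
exists K; split=> // n t st; have := HK n t st.
by rewrite iter_check_wcomp mulr1.
Qed.

(** As 0 is off the spectrum, the constant 1 is in the range of the operator, so [w] has no zero on
    the Shilov boundary. *)
Lemma weight_neq0 n t : shilov t -> weight n t != 0.
Proof.
move=> st; have w0 (s : chr) : shilov s -> s w != 0.
  move=> ss; have n0 : nm (0 : C) != 1 by rewrite nm0 eq_sym oner_eq0.
  have [_ onto] := check_resolvent (not_check_spectrum n0).
  have [y _ /(_ s ss)] := onto _ (checkA_char one).
  rewrite mul0r subr0 char1 /check_wcomp => H; apply/eqP => sw0.
  by move/eqP: H; rewrite sw0 mul0r eq_sym oner_eq0.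
elim: n => [|n IH]; first by rewrite /weight big_ord0 oner_eq0.
by rewrite weightS mulf_neq0 // w0 //; exact: shilov_iter_phi.
Qed.

(* The spectral radius bound is applied to the inverse operator
   [g |-> (g / w) o phi^-1]. *)
Lemma weight_lower (rho : R) : 0 < rho < 1 ->
  exists K, 0 < K /\ forall n t, shilov t -> rho ^+ n <= K * nm (weight n t).
Proof.
move=> /andP[rho_gt0 rho_lt1]; have [V [UV VU]] := aut_inverse U.
have phiVK : cancel (phi V) (phi U) := phiK UV.
have phiUK : cancel (phi U) (phi V) := phiK VU.
have w0 (s : chr) : shilov s -> s w != 0.
  by move=> /(weight_neq0 1); rewrite weightS /weight big_ord0 mul1r.
pose S g t : C := (phi V t w)^-1 * g (phi V t).
have TS g t : shilov t -> T (S g) t = g t.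
  by move=> st; rewrite /check_wcomp /S phiUK mulVKf // w0.
have ST g t : shilov t -> S (T g) t = g t.
  move=> st; rewrite /check_wcomp /S phiVK mulKf // w0 //; exact: shilov_phi.
have S_eq g h : eqOnS g h -> eqOnS (S g) (S h).
  by move=> gh t st; rewrite /S gh //; exact: shilov_phi.
have nosp (z : C) : nm z <= rho -> ~ check_spectrum T z.
  move=> zr; apply: not_check_spectrum; rewrite lt_eqF //.
  exact: le_lt_trans zr rho_lt1.
have n0 : nm (0 : C) <= rho by rewrite nm0 ltW.
have [[K0 [K0_ge0 HK0]] onto0] := check_resolvent (nosp 0 n0).
have DS g : checkA g -> checkA (S g).
  move=> Dg; have [y Dy yg] := onto0 g Dg; apply: checkA_eqOnS Dy => t st.
  by rewrite -(ST y t st); apply: S_eq st => s ss; rewrite -(yg s ss) mul0r subr0.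
have [|||||||K [K_gt0 HK]] := @check_radius (S : X -> X) K0 rho.
- by move=> a g h; apply/funext => t; rewrite /S /= mulrDr mulrCA.
- exact: DS.
- exact: K0_ge0.
- move=> g Dg; apply: le_trans (HK0 _ (DS g Dg)) _; rewrite ler_wpM2l //.
  by rewrite le_eqVlt; apply/orP; left; apply/eqP; apply: supS_eq => t st;
    rewrite TS // mul0r subr0.
- exact: rho_gt0.
(* Here [1 - z S = (T - z) S], so the resolvent of [T] at [z] supplies the lower bound, and below,
   after applying [T], the solutions. *)
- move=> z zr; have [[K [K_ge0 HK]] _] := check_resolvent (nosp z zr).
  exists (nm w * K) => g Dg; have DSg := DS g Dg.
  have -> : supS g = supS (T (S g)) by apply: supS_eq => t st; rewrite TS.
  apply: le_trans (supS_wcomp DSg) _; rewrite -mulrA ler_wpM2l ?nm_ge0 //.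
  apply: le_trans (HK _ DSg) _; rewrite ler_wpM2l // le_eqVlt; apply/orP; left.
  by apply/eqP; apply: supS_eq => t st; rewrite TS.
- move=> z zr g Dg; have [_ onto] := check_resolvent (nosp z zr).
  have [y Dy yg] := onto g Dg; exists (T y); first exact: checkA_wcomp.
  by move=> t st; rewrite ST // yg.
have iter_S n g t : iter n S g (iter n (phi U) t) = (weight n t)^-1 * g t.
  elim: n => [|n IH]; first by rewrite /weight big_ord0 invr1 mul1r.
  by rewrite !iterS /S phiUK IH weightS invfM mulrA; congr (_ * _); exact: mulrC.
exists K; split=> // n t st; have := HK n _ (shilov_iter_phi U n st).
rewrite iter_S mulr1 nmV mulrC ler_pdivrMr // lt_neqAle nm_ge0 andbT eq_sym.
by apply/eqP => /nm_eq0/eqP; apply/negP; exact: weight_neq0.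
Qed.

Lemma weight_bounds (rho : R) : 0 < rho < 1 ->
  exists K, 0 < K /\ forall n k t, shilov t ->
    nm (weight n t) * rho ^+ (n + k) <= K * nm (weight k t).
Proof.
move=> H; have [K1 [K1_gt0 HK1]] := weight_upper H.
have [K2 [K2_gt0 HK2]] := weight_lower H.
exists (K1 * K2); split; first by rewrite mulr_gt0.
move=> n k t st; have [/ltW rho_ge0 _] := andP H.
rewrite exprD mulrA -[leRHS]mulrA; apply: ler_pM; last exact: HK2.
- by rewrite mulr_ge0 ?nm_ge0 ?exprn_ge0.
- by rewrite exprn_ge0.
- exact: HK1.
Qed.

End Weighted.
End CheckAlgebra.

(** * Finitely supported sequences with small differences and prescribed zeros *)

(* A sequence is encoded as a polynomial, on which differencing is multiplication
   by ['X - 1].  The starting point is the [m]-th power of a moving average. *)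
Section TestPolynomial.
Variable R : realType.
Implicit Types (p : {poly R}) (M : R).

Definition coef_bound p M := forall k, `|p`_k| <= M.

Variable q : nat.
Hypothesis q_gt0 : (0 < q)%N.

Let avg : {poly R} := q%:R^-1 *: \sum_(i < q) 'X^i.

Let qR : 0 < q%:R :> R.
Proof. by rewrite ltr0n. Qed.

Lemma coef_bound_ge0 p M : coef_bound p M -> 0 <= M.
Proof. by move=> H; exact: le_trans (normr_ge0 _) (H 0%N). Qed.

Lemma coef_bound_avg p M : coef_bound p M -> coef_bound (avg * p) M.
Proof.
move=> Hp k; have M_ge0 := coef_bound_ge0 Hp.
rewrite /avg -scalerAl coefZ mulr_suml coef_sum normrM ger0_norm ?invr_ge0 ?(ltW qR) //.
rewrite mulrC ler_pdivrMr //; apply: le_trans (ler_norm_sum _ _ _) _.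
apply: (@le_trans _ _ (\sum_(i < q) M)); last first.
  by rewrite sumr_const card_ord mulr_natr.
by apply: ler_sum => i _; rewrite coefXnM; case: ifP => // _; rewrite normr0.
Qed.

(** Telescoping: [('X - 1) * avg = ('X^q - 1) / q], the source of the gain [2 / q] per
    difference. *)
Lemma coef_bound_diff p M : coef_bound p M ->
  coef_bound (('X - 1) * (avg * p)) (2 / q%:R * M).
Proof.
move=> Hp k; have M_ge0 := coef_bound_ge0 Hp.
have -> : ('X - 1) * (avg * p) = q%:R^-1 *: (('X^q - 1) * p).
  by rewrite mulrA /avg -scalerAr -subrX1 -scalerAl.
rewrite coefZ mulrBl mul1r coefB coefXnM normrM ger0_norm ?invr_ge0 ?(ltW qR) //.
rewrite mulrAC mulrC ler_pM2r ?invr_gt0 //.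
apply: le_trans (ler_normB _ _) _; have h1 := Hp k.
case: ifP => _; first by rewrite normr0; lra.
by have h2 := Hp (k - q)%N; lra.
Qed.

Variable m : nat.
Hypothesis m_gt0 : (0 < m)%N.
Local Notation theta := (2 / q%:R : R).
Local Notation sz := (q * m).+1.

(** Each difference is paired with one averaging factor; the remaining factors do not increase the
    bound. *)
Lemma coef_bound_base i : (i <= m)%N -> coef_bound (('X - 1) ^+ i * avg ^+ m) (theta ^+ i).
Proof.
move=> im; rewrite -(subnKC im) exprD mulrA -exprMn.
elim: i {im} (m - i)%N => [|i IH] j.
  rewrite expr0 mul1r; elim: j => [|j IH]; last by rewrite exprS; exact: coef_bound_avg.
  by move=> k; rewrite expr0 coef1; case: (k == 0%N); rewrite ?normr1 ?normr0.
by rewrite !exprS; move: (coef_bound_diff (IH j)); rewrite !mulrA.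
Qed.

Lemma size_base : (size (avg ^+ m) <= sz)%N.
Proof.
apply: leq_trans (size_poly_exp_leq _ _) _; rewrite ltnS leq_mul2r; apply/orP; right.
have : (size avg <= q)%N.
  apply: leq_trans (size_scale_leq _ _) _; apply: leq_trans (size_sum _ _ _) _.
  by apply/bigmax_leqP => i _; rewrite size_polyXn.
by move=> h; apply: leq_trans h; rewrite leq_pred.
Qed.

(** The coefficients sum to 1 and at most [sz] of them are nonzero. *)
Lemma base_peak : exists2 k0, (k0 < sz)%N & sz%:R^-1 <= `|(avg ^+ m)`_k0|.
Proof.
have h1 : (avg ^+ m).[1] = 1.
  rewrite horner_exp /avg hornerZ horner_sum.
  have -> : \sum_(i < q) ('X^i : {poly R}).[1] = q%:R.
    rewrite (eq_bigr (fun=> 1)) ?sumr_const ?card_ord // => i _.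
    by rewrite hornerXn expr1n.
  by rewrite mulVf ?expr1n // gt_eqF.
apply: contrapT => no.
have : `|(avg ^+ m).[1]| < 1.
  rewrite (horner_coef_wide _ size_base); apply: le_lt_trans (ler_norm_sum _ _ _) _.
  have e1 : \sum_(i < sz) sz%:R^-1 = 1 :> R.
    by rewrite sumr_const card_ord -[LHS]mulr_natr mulVf // pnatr_eq0.
  rewrite -[ltRHS]e1.
  apply: ltr_sum => [|i _]; first by apply/hasP; exists ord0 => //; exact: mem_index_enum.
  rewrite expr1n mulr1 ltNge; apply/negP => h; apply: no; exists (nat_of_ord i) => //.
by rewrite h1 normr1 ltxx.
Qed.

Section Kill.
Variable k0 : nat.
Hypothesis k0_sz : (k0 < sz)%N.

Definition test_bound p M := [/\ (size p <= sz)%N, p`_k0 = 1 &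
  forall i, (i <= m)%N -> coef_bound (('X - 1) ^+ i * p) (M * theta ^+ i)].

Lemma coef_euler p k : ('X * p^`())`_k = k%:R * p`_k.
Proof.
rewrite coefXM coef_deriv; case: k => [|k]; first by rewrite mul0r.
by rewrite /= mulr_natl.
Qed.

(** The commutator of the Euler operator ['X * d/dX], which multiplies the [k]-th coefficient by
    [k], with iterated differences: it costs a single difference. *)
Lemma leibniz_euler p i :
  ('X - 1) ^+ i * ('X * p^`()) =
  'X * (('X - 1) ^+ i * p)^`() - i%:R *: ('X * (('X - 1) ^+ i.-1 * p)).
Proof.
rewrite derivM deriv_exp derivB derivX derivC subr0 mul1r mulrDr.
rewrite scaler_nat -mulrnAr -mulrnAl addrAC subrr add0r.
by rewrite mulrCA.
Qed.

(* The coefficients are multiplied by the affine factor [(k1 - k) / (k1 - k0)]. *)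
Lemma test_bound_kill p M l (k1 : nat) : test_bound p M -> (0 < l)%N -> (k1 < sz)%N ->
  l%:R * (2 * q%:R + 2) <= `|k1%:R - k0%:R| :> R ->
  exists p', [/\ test_bound p' (M * (1 + m%:R / l%:R)), p'`_k1 = 0 &
    forall k, p`_k = 0 -> p'`_k = 0].
Proof.
move=> [szp pk0 pb] l_gt0 k1_sz far.
have lR : 0 < l%:R :> R by rewrite ltr0n.
have mR : 1 <= m%:R :> R by rewrite ler1n.
pose d : R := k1%:R - k0%:R.
have d_gt0 : 0 < `|d|.
  by apply: lt_le_trans far; rewrite mulr_gt0 //; have := qR; lra.
have d0 : d != 0 by rewrite -normr_gt0.
pose p' := d^-1 *: (k1%:R *: p - 'X * p^`()).
have p'E k : p'`_k = (k1%:R - k%:R) / d * p`_k.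
  by rewrite coefZ coefB coefZ coef_euler; field.
have M_ge0 : 0 <= M.
  by have := coef_bound_ge0 (pb 0%N (leq0n _)); rewrite expr0 mulr1.
exists p'; split; last 2 first.
- by rewrite p'E subrr !mul0r.
- by move=> k pk; rewrite p'E pk mulr0.
split.
- apply/leq_sizeP => j jsz; rewrite p'E; move/leq_sizeP: szp => /(_ j jsz) ->.
  by rewrite mulr0.
- by rewrite p'E pk0 divff ?mulr1.
move=> i im k.
have th_gt0 : 0 < theta by rewrite divr_gt0.
have Mth : 0 <= M * theta ^+ i by rewrite mulr_ge0 // exprn_ge0 // ltW.
set a := ('X - 1) ^+ i * p; set b := ('X - 1) ^+ i.-1 * p.
have -> : (('X - 1) ^+ i * p')`_k =
    d^-1 * ((k1%:R - k%:R) * a`_k + i%:R * ('X * b)`_k).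
  rewrite /p' -scalerAr coefZ mulrBr leibniz_euler -scalerAr !coefB coefZ.
  by rewrite coef_euler coefZ; congr (_ * _); rewrite -/a -/b; ring.
have ha : `|(k1%:R - k%:R) * a`_k| <= (sz + m)%:R * (M * theta ^+ i).
  have [sk|ks] := leqP (sz + m) k.
    have -> : a`_k = 0.
      apply/nth_default; apply: leq_trans sk; rewrite /a.
      apply: leq_trans (size_mul_leq _ _) _.
      rewrite -polyC1 size_exp_XsubC /=; by rewrite addnC leq_add.
    by rewrite mulr0 normr0 mulr_ge0.
  rewrite normrM; apply: ler_pM => //; last exact: pb.
  by rewrite ler_norml; apply/andP; split;
    [rewrite lerBrDl addrC -lerBrDl opprK -natrD ler_nat|rewrite lerBlDl -natrD ler_nat]; lia.
(* The lost difference costs a factor [1 / theta = q / 2], bounded here by [q]; for [i = 0] the term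
   vanishes. *)
have hb : `|i%:R * ('X * b)`_k| <= m%:R * q%:R * (M * theta ^+ i).
  case: i im @a @b Mth ha => [|i] im a b Mth ha.
    by rewrite mul0r normr0 !mulr_ge0.
  rewrite normrM normr_nat -mulrA; apply: ler_pM => //; first by rewrite ler_nat.
  rewrite coefXM; case: (k == 0%N); first by rewrite normr0 mulr_ge0.
  apply: le_trans (pb i (ltnW im) _) _.
  have -> : q%:R * (M * theta ^+ i.+1) = 2 * (M * theta ^+ i).
    by rewrite exprS; field; rewrite gt_eqF.
  have : 0 <= M * theta ^+ i by rewrite mulr_ge0 // exprn_ge0 // ltW.
  lra.
rewrite normrM normfV mulrC ler_pdivrMr //.
apply: le_trans (ler_normD _ _) _.
(* The two terms add up to at most [m * (2 * q + 2)]. Distances are therefore measured in units of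
   [2 * q + 2]: at distance [l] units the loss is [m / l]. *)
apply: (@le_trans _ _ ((m%:R * (2 * q%:R + 2)) * (M * theta ^+ i))).
  have : (sz + m)%:R + m%:R * q%:R <= m%:R * (2 * q%:R + 2) :> R.
    have -> : m%:R * (2 * q%:R + 2) = (m * (2 * q + 2))%:R :> R.
      by rewrite natrM natrD natrM.
    by rewrite -natrM -natrD ler_nat; move: m_gt0; nia.
  move=> /(ler_wpM2r Mth); lra.
have : m%:R * (2 * q%:R + 2) <= (1 + m%:R / l%:R) * `|d|.
  apply: (@le_trans _ _ (m%:R / l%:R * `|d|)).
    rewrite mulrAC ler_pdivlMr // -mulrA ler_wpM2l //.
    by rewrite mulrC.
  by rewrite ler_wpM2r // lerDr.
move=> /(ler_wpM2r Mth); lra.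
Qed.

(** [Q] is the set of return times in one window. If none lies within the degree range, [p] itself
    serves. *)
Lemma test_bound_kill_unique p M l (Q : nat -> Prop) : test_bound p M -> (0 < l)%N ->
  (forall k k', Q k -> Q k' -> k = k') ->
  (forall k, Q k -> l%:R * (2 * q%:R + 2) <= `|k%:R - k0%:R| :> R) ->
  exists p', [/\ test_bound p' (M * (1 + m%:R / l%:R)),
    forall k, Q k -> p'`_k = 0 & forall k, p`_k = 0 -> p'`_k = 0].
Proof.
move=> tp l_gt0 Quniq Qfar.
have [[k1 [Qk1 k1_sz]]|noQ] := pselect (exists k, Q k /\ (k < sz)%N).
  have [p' [tp' p'k1 p'0]] := test_bound_kill tp l_gt0 k1_sz (Qfar _ Qk1).
  by exists p'; split=> // k Qk; rewrite (Quniq _ _ Qk Qk1).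
have [szp pk0 pb] := tp; exists p; split=> //.
  split=> // i im k; apply: le_trans (pb i im k) _.
  have M_ge0 : 0 <= M.
    by have := coef_bound_ge0 (pb 0%N (leq0n _)); rewrite expr0 mulr1.
  rewrite ler_wpM2r ?exprn_ge0 ?divr_ge0 // ler_peMr // lerDl divr_ge0 //.
move=> k Qk; move/leq_sizeP: szp; apply; rewrite leqNgt; apply/negP => ks.
by apply: noQ; exists k.
Qed.

(** The product is the binomial coefficient [C(m + b, b)]. *)
Lemma prod_shift_bound (b : nat) :
  \prod_(l < b) (1 + m%:R / l.+1%:R) <= 2 ^+ (m + b) :> R.
Proof.
have -> : \prod_(l < b) (1 + m%:R / l.+1%:R) = 'C(m + b, b)%:R :> R.
  elim: b => [|b IH]; first by rewrite big_ord0 bin0.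
  rewrite big_ord_recr /= IH.
  have b0 : b.+1%:R != 0 :> R by rewrite pnatr_eq0.
  have key : 'C(m + b.+1, b.+1)%:R * b.+1%:R = (m%:R + b.+1%:R) * 'C(m + b, b)%:R :> R.
    by rewrite -natrD -!natrM mulnC -mul_bin_diag addnS.
  by apply: (mulIf b0); rewrite key -mulrA mulrDl mul1r divfK // mulrC addrC.
rewrite -natrX ler_nat; move: (m + b)%N => n; elim: n b => [|n IH] [|k] //.
  by rewrite bin0 expn_gt0.
by rewrite binS expnS mul2n -addnn leq_add.
Qed.

(** By the gap condition a window of length [2 * q + 2] holds at most one return time, and the
    windows adjacent to [k0] hold none besides [k0]. The [l]-th window on each side costs
    [1 + m / l]; the two sides give the square. *)
Lemma test_bound_killed (Ret : nat -> Prop) p M b :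
  (forall k k', Ret k -> Ret k' -> (k < k')%N -> (2 * q + 2 <= k' - k)%N) ->
  Ret k0 -> test_bound p M ->
  exists p', test_bound p' (M * (\prod_(l < b) (1 + m%:R / l.+1%:R)) ^+ 2) /\
    forall k, Ret k -> k <> k0 -> (k < k0 + b.+1 * (2 * q + 2))%N ->
      (k0 < k + b.+1 * (2 * q + 2))%N -> p'`_k = 0.
Proof.
move=> gap Rk0 tp; elim: b => [|b [p1 [tp1 Hp1]]].
  exists p; rewrite big_ord0 expr1n mulr1; split=> // k Rk /eqP; rewrite neq_ltn.
  by move=> /orP[] lt; [have := gap _ _ Rk Rk0 lt|have := gap _ _ Rk0 Rk lt]; lia.
pose N := (2 * q + 2)%N.
have NR : (2 * q%:R + 2) = N%:R :> R by rewrite natrD natrM.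
pose Q1 k := Ret k /\ (k0 + b.+1 * N <= k < k0 + b.+2 * N)%N.
pose Q2 k := Ret k /\ (k + b.+1 * N <= k0 < k + b.+2 * N)%N.
have [|||p2 [tp2 p2Q p2z]] := @test_bound_kill_unique p1 _ b.+1 Q1 tp1.
- by [].
- move=> k k' [Rk hk] [Rk' hk']; case: (ltngtP k k') => // lt.
    by have := gap _ _ Rk Rk' lt; rewrite -/N; lia.
  by have := gap _ _ Rk' Rk lt; rewrite -/N; lia.
- move=> k [_ /andP[hk _]]; rewrite NR -natrM.
  by apply: le_trans (ler_norm _); rewrite lerBrDl -natrD ler_nat.
have [|||p3 [tp3 p3Q p3z]] := @test_bound_kill_unique p2 _ b.+1 Q2 tp2.
- by [].
- move=> k k' [Rk hk] [Rk' hk']; case: (ltngtP k k') => // lt.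
    by have := gap _ _ Rk Rk' lt; rewrite -/N; lia.
  by have := gap _ _ Rk' Rk lt; rewrite -/N; lia.
- move=> k [_ /andP[hk _]]; rewrite NR -natrM distrC.
  by apply: le_trans (ler_norm _); rewrite lerBrDl -natrD ler_nat.
exists p3; split; first by rewrite big_ord_recr /= exprMn expr2 !mulrA in tp3 *.
move=> k Rk kk0 h1 h2.
have [in1|out1] := boolP (k0 + b.+1 * N <= k)%N.
  by apply: p3z; apply: p2Q; split=> //; rewrite in1.
have [in2|out2] := boolP (k + b.+1 * N <= k0)%N.
  by apply: p3Q; split=> //; rewrite in2.
by apply: p3z; apply: p2z; apply: Hp1; rewrite // ltnNge.
Qed.

End Kill.

Theorem test_polynomial : exists2 k0, (k0 <= q * m)%N &
  forall Ret : nat -> Prop,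
  (forall k k', Ret k -> Ret k' -> (k < k')%N -> (2 * q + 2 <= k' - k)%N) ->
  Ret k0 -> exists p, [/\ (size p <= (q * m).+1)%N, p`_k0 = 1,
    forall k, Ret k -> k <> k0 -> p`_k = 0 &
    forall i k, (i <= m)%N ->
      `|(('X - 1) ^+ i * p)`_k| <= (q * m).+1%:R * 16 ^+ m * (2 / q%:R) ^+ i].
Proof.
have [k0 k0_sz peak] := base_peak; exists k0 => // Ret gap Rk0.
have szR : 0 < sz%:R^-1 :> R by rewrite invr_gt0.
have c_gt0 := lt_le_trans szR peak.
set c := (avg ^+ m)`_k0 in peak c_gt0.
have c0 : c != 0 by rewrite -normr_gt0.
have tp0 : test_bound k0 (c^-1 *: avg ^+ m) sz%:R.
  split.
  - exact: leq_trans (size_scale_leq _ _) size_base.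
  - by rewrite coefZ mulVf.
  move=> i im k; rewrite -scalerAr coefZ normrM; apply: ler_pM => //.
    by rewrite normfV -[leRHS]invrK lef_pV2 ?posrE.
  exact: coef_bound_base.
(* With [b = m], the reach [(m + 1) * (2 * q + 2)] exceeds the degree [q * m], so every other return
   time in range is killed. *)
have [p [tp p0]] := test_bound_killed k0_sz m gap Rk0 tp0.
have [szp pk0 pb] := tp; exists p; split=> //.
  move=> k Rk kk0; have [sk|ks] := leqP sz k.
    by move/leq_sizeP: szp; apply.
  by apply: p0 => //; move: ks k0_sz; nia.
move=> i k im; apply: le_trans (pb i im k) _.
rewrite ler_wpM2r ?exprn_ge0 ?divr_ge0 // ler_wpM2l //.
have h := prod_shift_bound m.
have h0 : 0 <= \prod_(l < m) (1 + m%:R / l.+1%:R) :> R.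
  by apply: prodr_ge0 => l _; rewrite addr_ge0 // divr_ge0.
apply: le_trans (lerXn2r 2 _ _ h) _; rewrite ?nnegrE ?exprn_ge0 //.
(* Both sides together cost [(2^(m + m))^2 = 16^m]. *)
rewrite -exprM (_ : ((m + m) * 2 = 4 * m)%N) ?exprM; last by lia.
by rewrite (_ : 2 ^+ 4 = 16 :> R) // -natrX.
Qed.

End TestPolynomial.

(** * Orbit sequences and the theorem *)

Section Summation.
Variable R : realType.
Local Notation C := R[i].
Implicit Types (x : nat -> C) (p : {poly R}).

Definition fdiff x : nat -> C := fun k => x k.+1 - x k.

Definition pairing n p x : C := \sum_(k < n) ((p`_k)%:C)%C * x k.

(** Summation by parts; the end terms vanish because [p] has no coefficient at or beyond [n], and
    the range grows by one. *)
Lemma pairing_fdiff n p x : (size p <= n)%N ->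
  pairing n p (fdiff x) = pairing n.+1 (('X - 1) * p) x.
Proof.
move=> szp; rewrite /pairing /fdiff.
rewrite (eq_bigr (fun k : 'I_n => ((p`_k)%:C)%C * x k.+1 - ((p`_k)%:C)%C * x k));
  last by move=> k _; rewrite mulrBr.
rewrite [RHS](eq_bigr (fun k : 'I_n.+1 =>
  ((('X * p)`_k)%:C)%C * x k - ((p`_k)%:C)%C * x k)); last first.
  by move=> k _; rewrite mulrBl mul1r coefB rmorphB /= mulrBl.
rewrite !sumrB; congr (_ - _).
  rewrite big_ord_recl coefXM /= mul0r add0r.
  by apply: eq_bigr => k _; rewrite coefXM.
by rewrite big_ord_recr /= nth_default // mul0r addr0.
Qed.

Lemma pairing_iter_fdiff n p x m : (size p <= n)%N ->
  pairing n p (iter m fdiff x) = pairing (n + m) (('X - 1) ^+ m * p) x.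
Proof.
elim: m n p => [|m IH] n p szp; first by rewrite addn0 mul1r.
rewrite iterS pairing_fdiff // IH; last first.
  apply: leq_trans (size_mul_leq _ _) _.
  by rewrite -polyC1 size_XsubC /= add1n.
by rewrite addSnnS exprSr mulrA.
Qed.

Lemma iter_fdiffZ (a : C) x m k :
  iter m fdiff (fun j => a * x j) k = a * iter m fdiff x k.
Proof. by elim: m k => //= m IH k; rewrite /fdiff !IH mulrBr. Qed.

Lemma nm_pairing n p x (B : R) : (forall k, (k < n)%N -> `|p`_k| * nm (x k) <= B) ->
  nm (pairing n p x) <= n%:R * B.
Proof.
move=> H; apply: le_trans (nm_sum _ (fun k => ((p`_k)%:C)%C * x k)) _.
apply: (@le_trans _ _ (\sum_(k < n) B)); last first.
  by rewrite sumr_const card_ord mulr_natl.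
by apply: ler_sum => k _; rewrite nmM nmC H.
Qed.

Lemma pairing_isolate n p x k0 : (k0 < n)%N -> p`_k0 = 1 ->
  pairing n p x = x k0 + pairing n p (fun k => if k == k0 then 0 else x k).
Proof.
move=> k0n pk0; rewrite /pairing (bigD1 (Ordinal k0n)) //= pk0 mul1r.
rewrite [in RHS](bigD1 (Ordinal k0n)) //= eqxx mulr0 add0r.
by congr (_ + _); apply: eq_bigr => k; rewrite -val_eqE /= => /negbTE ->.
Qed.

Lemma exp_beats_square (B : R) : exists2 m, (0 < m)%N & B * m%:R ^+ 2 < 2 ^+ m.
Proof.
pose n := (Num.bound `|16 * B|).+1.
have Bn : 16 * B < n%:R.
  apply: le_lt_trans (ler_norm _) _; apply: lt_le_trans (archi_boundP (normr_ge0 _)) _.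
  by rewrite ler_nat.
have n1 : 1 <= n%:R :> R by rewrite ler1n.
exists (4 * n)%N => //; rewrite mulnC exprM.
apply: (@lt_le_trans _ _ (n%:R ^+ 4)); last first.
  by rewrite lerXn2r ?nnegrE ?exprn_ge0 // -natrX ler_nat ltnW // ltn_expl.
have -> : B * (n * 4)%:R ^+ 2 = n%:R ^+ 2 * (16 * B) by rewrite natrM; ring.
rewrite (_ : n%:R ^+ 4 = n%:R ^+ 2 * n%:R ^+ 2 :> R); last by rewrite -exprD.
rewrite ltr_pM2l ?exprn_gt0 ?ltr0n //; apply: lt_le_trans Bn _.
by rewrite expr2 ler_peMr.
Qed.

(** This makes [rho^(n m)] at least [2^-m], so that over [n * m] steps the subexponential weights
    cost at most [2^m]. The witness comes from Bernoulli's inequality. *)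
Lemma root_half (n : nat) : exists rho : R, 0 < rho < 1 /\ 2^-1 <= rho ^+ n.
Proof.
pose x : R := (2 * n.+1%:R)^-1.
have n1 : 1 <= n.+1%:R :> R by rewrite ler1n.
have x_gt0 : 0 < x by rewrite invr_gt0 mulr_gt0 // ltr0n.
have xn : x * n.+1%:R = 2^-1 by rewrite /x; field; lra.
have x_le : x <= 2^-1.
  by rewrite -xn ler_peMr // ltW.
exists (1 - x); split; first by apply/andP; split; lra.
suff : 1 - x * n%:R <= (1 - x) ^+ n.
  by apply: le_trans; move: xn; rewrite -natr1; lra.
elim: (n) => [|k IH]; first by rewrite mulr0 subr0.
have x1 : 0 <= 1 - x by lra.
have := ler_wpM2l x1 IH; rewrite exprS -natr1.
have : 0 <= x * (x * k%:R) by rewrite !mulr_ge0 // ltW.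
lra.
Qed.

End Summation.

(** * Localized elements at a non-periodic peak point *)

Section Peak.
Variables (R : realType) (A : completeNormedModType R[i]).
Variables (mul : A -> A -> A) (one : A).
Hypothesis hA : comBanachAlg mul one.
Local Notation C := R[i].
Local Notation chr := (character mul one).
Variable U : algAut mul one.

(** The product [p * (p o phi^j)] attains its maximum modulus on the Shilov boundary; the value 1
    would put both points at [t] and make [t] periodic. The finitely many [j] are treated by
    induction. *)
Lemma orbit_separating_bound (t : chr) (p : chr -> C) (N : nat) : shilov t ->
  ~ periodic (phi U) t -> checkA p ->
  p t = 1 -> (forall s, shilov s -> s <> t -> nm (p s) < 1) ->
  exists d : R, [/\ 0 <= d, d < 1 & forall j s, (0 < j < N)%N -> shilov s ->
    nm (p s) * nm (p (iter j (phi U) s)) <= d].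
Proof.
move=> st nper Dp pt ps.
have p1 s : shilov s -> nm (p s) <= 1.
  move=> ss; have [->|/(ps s ss)/ltW//] := pselect (s = t).
  by rewrite pt nm1.
have pt1 s : shilov s -> 1 <= nm (p s) -> s = t.
  by move=> ss le1; apply: contrapT => /(ps s ss); rewrite ltNge le1.
elim: N => [|N [d [d_ge0 d_lt1 Hd]]].
  by exists 0; split=> // j s /andP[].
have [N0|N0] := posnP N.
  by exists 0; split=> // j s; rewrite N0 => /andP[]; case: j.
have [||b sb bmax] := @max_attained R A mul one hA _
  (fun s => p s * p (iter N (phi U) s)) (@gelfand_closed_shilov R A mul one).
- by exists t.
- by apply/checkAP; apply: checkA_mul => //; exact: checkA_iter_phi.
have sbN := shilov_iter_phi U N sb.
have blt : nm (p b * p (iter N (phi U) b)) < 1.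
  rewrite ltNge; apply/negP; rewrite nmM => le1; apply: nper.
  have h1 := p1 _ sb; have h2 := p1 _ sbN.
  have bt : b = t.
    apply: pt1 => //; apply: le_trans le1 _.
    by rewrite ler_piMr ?nm_ge0.
  exists N => //; rewrite bt in sbN le1 *; apply: pt1 => //.
  by move: le1; rewrite pt nm1 mul1r.
exists (Num.max d (nm (p b * p (iter N (phi U) b)))); split.
- by rewrite le_max d_ge0.
- by rewrite gt_max d_lt1 blt.
move=> j s /andP[j0 jN] ss; rewrite le_max; move: jN; rewrite ltnS leq_eqVlt.
case/orP => [/eqP->|jN].
  by apply/orP; right; rewrite -nmM; exact: bmax.
by apply/orP; left; apply: Hd => //; rewrite j0.
Qed.

(** A high power [r] of the peaking function satisfies [|r(s) r(phi^j s)| <= (eta / 4)^2], so [|r|]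
    cannot exceed [3/4 * eta] at both points. Approximation within [eta / 8] by an element of [A],
    divided by its value at [t] of modulus at least 7/8, turns this threshold into [eta]. *)
Lemma localized_element (t : chr) (N : nat) (eta : R) : 0 < eta <= 1 ->
  shilov t -> ~ periodic (phi U) t -> peak_point t ->
  exists g : A, [/\ t g = 1, forall s : chr, shilov s -> nm (s g) <= 2 &
    forall j (s : chr), (0 < j < N)%N -> shilov s -> eta < nm (s g) ->
      nm (iter j (phi U) s g) <= eta].
Proof.
move=> /andP[eta_gt0 eta_le1] st nper [p [Dp pt ps]].
have ps' s : shilov s -> s <> t -> nm (p s) < 1.
  by move=> ss nst; have := ps s ss nst; rewrite -[1]/((1%:C)%C) nm_ltC.
have p1 s : shilov s -> nm (p s) <= 1.
  move=> ss; have [->|/(ps' s ss)/ltW//] := pselect (s = t).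
  by rewrite pt nm1.
have [d [d_ge0 d_lt1 Hd]] := orbit_separating_bound N st nper Dp pt ps'.
have d01 : 0 <= d < 1 by rewrite d_ge0.
have e4 : 0 < (eta / 4) ^+ 2 by rewrite exprn_gt0 // divr_gt0.
have [P HP] := power_decay d01 e4; have {}HP := HP P (leqnn _).
pose r s := p s ^+ P.
have /checkAP Dr : checkA r by exact: checkA_exp.
have e8 : 0 < eta / 8 by rewrite divr_gt0.
have [g0 Hg0] := Dr _ e8.
have c78 : 7 / 8 <= nm (t g0).
  have := nm_tri (1 : C) (t g0); rewrite nm1; have := Hg0 t st.
  rewrite /r pt expr1n; lra.
have c_gt0 : 0 < nm (t g0) by lra.
have c0 : t g0 != 0.
  by apply/eqP => c0; move: c_gt0; rewrite c0 nm0 ltxx.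
have gE (s : chr) : nm (s ((t g0)^-1 *: g0)) = nm (s g0) / nm (t g0).
  by rewrite charZ nmM nmV mulrC.
have big (s : chr) : shilov s -> eta < nm (s ((t g0)^-1 *: g0)) -> 3 / 4 * eta < nm (r s).
  move=> ss; rewrite gE ltr_pdivlMr // => h1.
  have h2 := nm_tri (s g0) (r s); have h3 := Hg0 s ss; rewrite nmBC in h3.
  have : eta * (7 / 8) <= eta * nm (t g0) by rewrite ler_wpM2l // ltW.
  lra.
exists ((t g0)^-1 *: g0); split.
- by rewrite charZ mulVf.
- move=> s ss; rewrite gE ler_pdivrMr //.
  have h2 := nm_tri (s g0) (r s); have h3 := Hg0 s ss; rewrite nmBC in h3.
  have : nm (r s) <= 1 by rewrite nmX exprn_ile1 ?nm_ge0 ?p1.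
  lra.
move=> j s jN ss /(big s ss) h1; rewrite leNgt; apply/negP.
move=> /(big _ (shilov_iter_phi U j ss)) h2.
have h3 : nm (r s) * nm (r (iter j (phi U) s)) <= (eta / 4) ^+ 2.
  apply: le_trans HP; rewrite !nmX -exprMn lerXn2r ?nnegrE ?mulr_ge0 ?nm_ge0 //.
  exact: Hd.
have h4 : (3 / 4 * eta) * (3 / 4 * eta) < nm (r s) * nm (r (iter j (phi U) s)).
  by apply: ltr_pM => //; rewrite mulr_ge0 ?(ltW eta_gt0) // divr_ge0.
have h5 : 0 < eta * eta by rewrite mulr_gt0.
move: h3; rewrite expr2; lra.
Qed.

End Peak.

(** * Orbit sequences and powers of the resolvent *)

Section OrbitSequence.
Variables (R : realType) (A : completeNormedModType R[i]).
Variables (mul : A -> A -> A) (one : A) (U : algAut mul one) (w : A).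
Local Notation C := R[i].
Local Notation chr := (character mul one).

Lemma shilov_iter_phi_onto n (t : chr) : shilov t ->
  exists2 s, shilov s & iter n (phi U) s = t.
Proof.
have [V [UV VU]] := aut_inverse U.
move=> st; exists (iter n (phi V) t); first exact: shilov_iter_phi.
by elim: n => // n IH; rewrite iterSr iterS (phiK UV).
Qed.

Variables (S : A -> A) (lam : C).
Hypothesis lam_neq0 : lam != 0.
Hypothesis wcompS : forall f, wcomp U w (S f) - lam *: S f = f.

(** Without the power of [lam] this is the value at [s] of the [k]-th iterate of [wcomp U w] applied
    to [f]; the factor turns [wcomp U w - lam] into a difference in [k], up to a scalar. *)
Definition orbit_seq (s : chr) (f : A) (k : nat) : C :=
  lam^-1 ^+ k * weight U w k s * iter k (phi U) s f.

Lemma fdiff_orbit_seq s f k :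
  fdiff (orbit_seq s (S f)) k = lam^-1 * orbit_seq s f k.
Proof.
rewrite /fdiff /orbit_seq weightS iterS phiE -[X in _ = _ * (_ * _ X)](wcompS f).
by rewrite /wcomp charB charM charZ exprS; field.
Qed.

Lemma iter_fdiff_orbit_seq s f m k :
  iter m (@fdiff R) (orbit_seq s (iter m S f)) k = lam^-1 ^+ m * orbit_seq s f k.
Proof.
elim: m f k => [|m IH] f k; first by rewrite mul1r.
rewrite iterSr iterS.
have -> : fdiff (orbit_seq s (S (iter m S f))) =
    fun j => lam^-1 * orbit_seq s (iter m S f) j.
  by apply/funext => j; exact: fdiff_orbit_seq.
by rewrite iter_fdiffZ IH exprS mulrA.
Qed.

Lemma nm_orbit_seq s f k : nm lam = 1 ->
  nm (orbit_seq s f k) = nm (weight U w k s) * nm (iter k (phi U) s f).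
Proof. by move=> l1; rewrite !nmM nmX nmV l1 invr1 expr1n mul1r. Qed.

Lemma nm_pairing_orbit_seq s f m n (p : {poly R}) : (size p <= n)%N -> nm lam = 1 ->
  nm (pairing n p (orbit_seq s f)) =
  nm (pairing (n + m) (('X - 1) ^+ m * p) (orbit_seq s (iter m S f))).
Proof.
move=> szp l1; rewrite -pairing_iter_fdiff //.
have -> : iter m (@fdiff R) (orbit_seq s (iter m S f)) =
    fun k => lam^-1 ^+ m * orbit_seq s f k.
  by apply/funext => k; exact: iter_fdiff_orbit_seq.
rewrite /pairing [in RHS](eq_bigr (fun k : 'I_n =>
  lam^-1 ^+ m * (((p`_k)%:C)%C * orbit_seq s f k))).
  by rewrite -mulr_sumr nmM nmX nmV l1 invr1 expr1n mul1r.
by move=> k _; rewrite mulrCA.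
Qed.

End OrbitSequence.

Lemma orbit_range q m k k0 : (k < (q * m).+1 + m)%N -> (k0 <= q * m)%N ->
  (k + k0 <= (2 * q + 1) * m)%N.
Proof. by rewrite mulnDl -mulnA; lia. Qed.

Lemma window_size q m : (0 < m)%N -> ((q * m).+1 + m <= (q + 2) * m)%N.
Proof. by rewrite mulnDl; lia. Qed.

(** * Growth comparison along a backward-shifted orbit of a peak point *)

Theorem theorem3 (R : realType) (A : completeNormedModType R[i])
    (mul : A -> A -> A) (one : A)
    (hA : comBanachAlg mul one) (hss : semisimple mul one)
    (U : algAut mul one) (w : A) :
  (forall n : nat, (0 < n)%N -> iter n U <> id) ->
  (forall lam, check_spectrum (check_wcomp U w) lam -> `|lam| = 1) ->
  (forall t : character mul one, shilov t -> ~ periodic (phi U) t) ->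
  (forall t : character mul one, shilov t -> peak_point t) ->
  forall lam : R[i], `|lam| = 1 -> spectrum (wcomp U w) lam.
Proof.
move=> Unid spT nper peak lam lam1 [S [S_lin [K0 HK0] _ TS]].
(* Without characters, semisimplicity would reduce [A] to 0 and make [U] the identity. *)
have chr_inh : exists m : character mul one, True.
  apply: contrapT => nochr; apply: (Unid 1%N) => //; apply/funext => x /=.
  have all0 (y : A) : y = 0 by apply: hss => m; exfalso; apply: nochr; exists m.
  by apply: etrans (all0 _) _; apply: esym (all0 _).
have l1 : nm lam = 1 by rewrite /nm lam1.
have lam0 : lam != 0.
  by apply/eqP => l0; move/eqP: l1; rewrite l0 nm0 eq_sym oner_eq0.
pose K := 1 + `|K0|; have K_ge1 : 1 <= K by rewrite lerDl.
have K_gt0 : 0 < K by apply: lt_le_trans K_ge1.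
have HS x : nm (S x) <= K * nm x.
  have := HK0 x; rewrite -!nmE -rmorphM lecR => /le_trans; apply.
  rewrite ler_wpM2r ?nm_ge0 // (le_trans (ler_norm _)) // lerDr //.
have HSm m x : nm (iter m S x) <= K ^+ m * nm x.
  elim: m => [|m IH]; first by rewrite mul1r.
  apply: le_trans (HS _) _; rewrite exprS -mulrA ler_wpM2l // ltW //.
(* The rate on the resolvent side is [16 * (2 / q) * 2 * K * 4 = 256 * K / q], which this choice
   brings to at most 1/2. *)
have [q [q_gt0 qK]] : exists q : nat, (0 < q)%N /\ 512 * K <= q%:R.
  exists (Num.bound (512 * K)).+1; split=> //.
  apply: le_trans (ltW (archi_boundP _)) _; first by rewrite mulr_ge0 // ltW.
  by rewrite ler_nat.
have qR : 0 < q%:R :> R by rewrite ltr0n.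
(* The weights at [k] and [k0] are compared at the cost [rho^-(k + k0)], and [k + k0] stays within
   [(2 * q + 1) * m]. *)
have [rho [rho01 rho_half]] := root_half R (2 * q + 1).
have [D [D_gt0 HD]] := weight_bounds hA chr_inh spT rho01.
have [rho_gt0 rho_lt1] := andP rho01.
have [t st] := shilov_inh hA chr_inh.
(* At non-return times [64^-m] pays for [16^m] from the test polynomial and [2^m] from the weights,
   leaving [2^-m]. *)
have eta01 : 0 < (64^-1 : R) <= 1 by rewrite invr_gt0 ltr0n /=; lra.
have [g [tg g2 gsep]] := localized_element hA (2 * q + 2) eta01 st (nper t st) (peak t st).
have gB (m : character mul one) : nm (m g) <= 2.
  have [b sb bmax] := boundary_shilov hA chr_inh g.
  by apply: le_trans (g2 b sb); have := bmax m; rewrite nm_le.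
have two_gt0 : 0 < 2 :> R by [].
have [G [G_gt0 HG]] := pow_growth hA two_gt0 gB.
(* [D] and [G] are already fixed. The error terms at non-return times and on the resolvent side are
   at most [(q + 2)^2 m^2 2^-m] times [D] and [D * G], relative to the isolated term [w0]. *)
have [m m_gt0 Hm] := exp_beats_square ((q + 2)%:R ^+ 2 * (D * (1 + G))).
have [k0 k0_le Hk0] := test_polynomial R q_gt0 m_gt0.
(* The orbit starts [k0] steps before [t], so that the index at which the test polynomial equals 1
   is the visit to [t]. *)
have [s ss st0] := shilov_iter_phi_onto U k0 st.
have Ret0 : 64^-1 < nm (iter k0 (phi U) s g) by rewrite st0 tg nm1; lra.
have [|p [szp pk0 pRet pB]] := Hk0 (fun k => 64^-1 < nm (iter k (phi U) s g)) _ Ret0.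
  move=> k k' Rk Rk' kk'; rewrite leqNgt; apply/negP => close.
  have jN : (0 < k' - k < 2 * q + 2)%N by rewrite subn_gt0 kk'.
  have := gsep _ _ jN (shilov_iter_phi U k ss) Rk.
  by rewrite -iterD subnK ?(ltnW kk') // leNgt Rk'.
set h := alg_pow mul one g m; set sz := (q * m).+1 in szp pB.
pose w0 := nm (weight U w k0 s).
have w0_gt0 : 0 < w0.
  rewrite lt_neqAle nm_ge0 andbT eq_sym; apply/eqP => /nm_eq0/eqP.
  by apply/negP; exact: (weight_neq0 hA chr_inh spT).
have wk k : (k < sz + m)%N -> nm (weight U w k s) <= D * w0 * 2 ^+ m.
  move=> ksz; have := HD k k0 s ss; rewrite -/w0 => h1.
  have h2 : rho ^+ ((2 * q + 1) * m) <= rho ^+ (k + k0).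
    apply: ler_wiXn2l; rewrite ?(ltW rho_gt0) ?(ltW rho_lt1) //.
    exact: orbit_range.
  have h3 : 2^-1 ^+ m <= rho ^+ ((2 * q + 1) * m).
    rewrite exprM; apply: lerXn2r; rewrite ?nnegrE ?exprn_ge0 ?invr_ge0 ?(ltW rho_gt0) //.
  have h4 : nm (weight U w k s) * 2^-1 ^+ m <= D * w0.
    apply: le_trans h1; rewrite ler_wpM2l ?nm_ge0 //; exact: le_trans h3 h2.
  by move: h4; rewrite exprVn ler_pdivrMr ?exprn_gt0.
pose x := orbit_seq U w lam s h; pose y := orbit_seq U w lam s (iter m S h).
have xy : nm (pairing sz p x) = nm (pairing (sz + m) (('X - 1) ^+ m * p) y).
  exact: (nm_pairing_orbit_seq lam0 TS).
have nx k : nm (x k) = nm (weight U w k s) * nm (iter k (phi U) s g) ^+ m.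
  by rewrite nm_orbit_seq // char_pow nmX.
have half16 : 16 ^+ m * 2 ^+ m * 64^-1 ^+ m = 2^-1 ^+ m :> R.
  by rewrite -!exprMn; congr (_ ^+ _); field.
have lhs : w0 <= nm (pairing sz p x) + sz%:R * (sz%:R * D * w0 * 2^-1 ^+ m).
  pose x' k := if k == k0 then 0 else x k.
  have xk0 : nm (x k0) = w0 by rewrite nx st0 tg nm1 expr1n mulr1.
  have -> : pairing sz p x = x k0 + pairing sz p x' by exact: pairing_isolate.
  have h1 : nm (pairing sz p x') <= sz%:R * (sz%:R * D * w0 * 2^-1 ^+ m).
    have B_ge0 : 0 <= sz%:R * D * w0 * 2^-1 ^+ m.
      by rewrite !mulr_ge0 ?exprn_ge0 ?invr_ge0 ?(ltW D_gt0) ?(ltW w0_gt0).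
    apply: nm_pairing => k ksz; rewrite /x'; case: eqP => [_|kk0].
      by rewrite nm0 mulr0.
    have [Rk|nRk] := ltP 64^-1 (nm (iter k (phi U) s g)).
      by rewrite (pRet k Rk kk0) normr0 mul0r.
    have hp : `|p`_k| <= sz%:R * 16 ^+ m.
      by have := pB 0%N k (leq0n _); rewrite !expr0 mul1r mulr1.
    have hg : nm (iter k (phi U) s g) ^+ m <= 64^-1 ^+ m.
      by apply: lerXn2r; rewrite ?nnegrE ?nm_ge0 ?invr_ge0.
    have hw := wk k (ltn_addr m ksz); rewrite nx.
    apply: (@le_trans _ _ ((sz%:R * 16 ^+ m) * ((D * w0 * 2 ^+ m) * 64^-1 ^+ m))).
      by apply: ler_pM => //; [rewrite mulr_ge0 ?nm_ge0 ?exprn_ge0 ?nm_ge0|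
        apply: ler_pM => //; rewrite ?exprn_ge0 ?nm_ge0].
    by rewrite le_eqVlt; apply/orP; left; apply/eqP; rewrite -half16; ring.
  rewrite -[leLHS]xk0; apply: le_trans (nm_tri (x k0) (- pairing sz p x')) _.
  by rewrite opprK nmN addrC lerD2l.
have rhs : nm (pairing (sz + m) (('X - 1) ^+ m * p) y) <=
    (sz + m)%:R * (sz%:R * D * w0 * G * 2^-1 ^+ m).
  apply: nm_pairing => k ksz.
  have hp := pB m k (leqnn _); have hw := wk k ksz.
  have hf : nm (iter k (phi U) s (iter m S h)) <= K ^+ m * (G * (2 * 2) ^+ m).
    apply: le_trans (char_bound hA _ _) _; apply: le_trans (HSm m h) _.
    by rewrite ler_wpM2l ?exprn_ge0 ?(ltW K_gt0) // HG.
  rewrite nm_orbit_seq //.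
  apply: (@le_trans _ _ ((sz%:R * 16 ^+ m * (2 / q%:R) ^+ m) *
      ((D * w0 * 2 ^+ m) * (K ^+ m * (G * (2 * 2) ^+ m))))).
    by apply: ler_pM => //; [rewrite mulr_ge0 ?nm_ge0|
      apply: ler_pM => //; rewrite ?nm_ge0].
  have -> : sz%:R * 16 ^+ m * (2 / q%:R) ^+ m *
      (D * w0 * 2 ^+ m * (K ^+ m * (G * (2 * 2) ^+ m))) =
      sz%:R * D * w0 * G * (16 ^+ m * (2 / q%:R) ^+ m * 2 ^+ m * K ^+ m * (2 * 2) ^+ m).
    by ring.
  rewrite -!exprMn ler_wpM2l //.
    by rewrite !mulr_ge0 ?(ltW D_gt0) ?(ltW w0_gt0) ?(ltW G_gt0).
  apply: lerXn2r; rewrite ?nnegrE ?invr_ge0 //.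
    by rewrite !mulr_ge0 ?invr_ge0 ?(ltW K_gt0).
  have -> : 16 * (2 / q%:R) * 2 * K * (2 * 2) = (256 * K) / q%:R :> R by ring.
  rewrite ler_pdivrMr //; lra.
have szm : (sz + m)%:R <= (q + 2)%:R * m%:R :> R.
  by rewrite -natrM ler_nat; exact: window_size.
have sz_le : sz%:R <= (sz + m)%:R :> R by rewrite ler_nat leq_addr.
have sz_ge0 : 0 <= sz%:R :> R by [].
pose c := w0 * 2^-1 ^+ m * D.
have c_ge0 : 0 <= c.
  by rewrite !mulr_ge0 ?exprn_ge0 ?invr_ge0 ?(ltW w0_gt0) ?(ltW D_gt0).
have sq : sz%:R * sz%:R <= ((q + 2)%:R * m%:R) ^+ 2 :> R.
  by rewrite expr2; apply: ler_pM => //; apply: le_trans szm.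
have sq' : (sz + m)%:R * sz%:R <= ((q + 2)%:R * m%:R) ^+ 2 :> R.
  by rewrite expr2; apply: ler_pM => //; apply: le_trans szm.
have t1 := ler_wpM2r c_ge0 sq.
have t2 := ler_wpM2r (mulr_ge0 c_ge0 (ltW G_gt0)) sq'.
have tot : w0 <= w0 * 2^-1 ^+ m * ((q + 2)%:R ^+ 2 * (D * (1 + G)) * m%:R ^+ 2).
  rewrite xy in lhs; move: t1 t2; rewrite exprMn /c => t1 t2; lra.
have : 2 ^+ m <= (q + 2)%:R ^+ 2 * (D * (1 + G)) * m%:R ^+ 2.
  move: tot; rewrite -mulrA -{1}[w0]mulr1 ler_pM2l // exprVn.
  by rewrite mulrC ler_pdivlMr ?exprn_gt0 // mul1r.
by rewrite leNgt Hm.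
Qed.
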